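(* Let $n\ge2$ and $1\le k\le n-1$. Then $\mathcal D^\ast_{n,k}$ is a $\bmod 2$-homology sphere. That is, for every face $\sigma$ of $\mathcal D^\ast_{n,k}$ (including $\sigma=\emptyset$, with $\dim\emptyset=-1$), $$H_\ast(\mathrm{link}_{\mathcal D^\ast_{n,k}}(\sigma);\mathbb Z_2)\cong H_\ast(S^{k(n-k)-1-\dim\sigma-1};\mathbb Z_2).$$ In particular, $H_\ast(\mathcal D^\ast_{n,k};\mathbb Z_2)\cong H_\ast(S^{k(n-k)-1};\mathbb Z_2)$.
   Context: Label the vertices of a convex regular $2n$-gon by $1,\dots,2n$ in cyclic order. A segment is a $2$-subset $\{a,b\}\subseteq[2n]$. Two segments cross if their four endpoints are distinct and interleave in the cyclic order. A $(k+1)$-crossing is a set of $k+1$ pairwise crossing segments. The cyclic length of $\{a,b\}$ is $\min(|a-b|,2n-|a-b|)$, and $\Omega_{2n,k}$ is the set of segments of cyclic length $>k$. The $180^\circ$-rotation sends $\{a,b\}$ to $\{a+n,b+n\}$ (indices mod $2n$). $\mathcal F_{n,k}$ is the set of rotation orbits of segments in $\Omega_{2n,k}$. $\mathcal D^\ast_{n,k}$ is the simplicial complex on $\mathcal F_{n,k}$ whose faces are the sets of orbits whose union contains no $(k+1)$-crossing. For a face $\sigma$ of a complex $\Delta$, $\mathrm{link}_\Delta(\sigma)=\{\tau\in\Delta:\tau\cup\sigma\in\Delta,\ \tau\cap\sigma=\emptyset\}$. *)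

(* Defs.v *)
From HB Require Import structures.
From mathcomp Require Import all_boot all_order all_fingroup all_algebra.

Set Implicit Arguments.
Unset Strict Implicit.
Unset Printing Implicit Defensive.

Import GRing.Theory.
Local Open Scope ring_scope.

(* A simplicial complex with vertices in [V] is its set of faces, of type
   [{set {set V}}]; the empty set counts as a face. *)

Definition face_dim (V : finType) (sigma : {set V}) : int := #|sigma|%:Z - 1.

Definition link (V : finType) (Delta : {set {set V}}) (sigma : {set V}) :
    {set {set V}} :=
  [set tau in Delta | (tau :|: sigma \in Delta) & (tau :&: sigma == set0)].

(* Mod 2 simplicial chains of all degrees at once: a chain assigns a
   coefficient to every finite set of vertices. *)
Definition chain (V : finType) : Type := {ffun {set V} -> 'F_2}.

HB.instance Definition _ (V : finType) := GRing.Zmodule.on (chain V).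
HB.instance Definition _ (V : finType) := Finite.on (chain V).
HB.instance Definition _ (V : finType) := [finGroupMixin of chain V for +%R].

Definition chains (V : finType) (Delta : {set {set V}}) (i : nat) :
    {set chain V} :=
  [set c : chain V |
    [forall F : {set V}, (c F != 0) ==> (F \in Delta) && (#|F| == i.+1)]].

(* The linear map sending a simplex [F] to the sum of the [F :\ v], [v \in F],
   written in coordinates. The coefficient on [set0] is set to 0: homology is
   not reduced, so vertices have zero boundary. *)
Definition boundary (V : finType) (c : chain V) : chain V :=
  [ffun F : {set V} =>
    if F == set0 then 0 else \sum_(v in ~: F) c (v |: F)].

Definition cycles (V : finType) (Delta : {set {set V}}) (i : nat) :
    {set chain V} :=
  [set c in chains Delta i | boundary c == 0].

Definition boundaries (V : finType) (Delta : {set {set V}}) (i : nat) :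
    {set chain V} :=
  [set boundary c | c in chains Delta i.+1].

Lemma boundary0 (V : finType) : boundary (0 : chain V) = 0.
Proof.
apply/ffunP => F; rewrite !ffunE; case: ifP => // _.
by rewrite big1 // => v _; rewrite ffunE.
Qed.

Lemma boundaryD (V : finType) (c d : chain V) :
  boundary (c + d) = boundary c + boundary d.
Proof.
apply/ffunP => F; rewrite !ffunE; case: ifP => _; first by rewrite addr0.
by rewrite -big_split; apply: eq_bigr => v _; rewrite ffunE.
Qed.

Lemma chains0 (V : finType) (Delta : {set {set V}}) i : 0 \in chains Delta i.
Proof. by rewrite inE; apply/forallP => F; rewrite ffunE eqxx. Qed.

Lemma chainsD (V : finType) (Delta : {set {set V}}) i (c d : chain V) :
  c \in chains Delta i -> d \in chains Delta i -> c + d \in chains Delta i.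
Proof.
rewrite !inE => /forallP cP /forallP dP; apply/forallP => F.
apply/implyP; rewrite ffunE => cdF; move: (cP F) (dP F).
by have [c0|//] := eqVneq (c F) 0; move: cdF; rewrite c0 add0r => ->.
Qed.

Lemma cycles_group_set (V : finType) (Delta : {set {set V}}) i :
  group_set (cycles Delta i).
Proof.
apply/group_setP; split=> [|c d].
  by rewrite inE (chains0 Delta i) boundary0 eqxx.
rewrite inE => /andP[cC /eqP c0]; rewrite inE => /andP[dC /eqP d0].
by rewrite inE (chainsD cC dC) boundaryD c0 d0 addr0 eqxx.
Qed.
Canonical cycles_group (V : finType) (Delta : {set {set V}}) i :=
  Group (cycles_group_set Delta i).

Lemma boundaries_group_set (V : finType) (Delta : {set {set V}}) i :
  group_set (boundaries Delta i).
Proof.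
apply/group_setP; split=> [|c d].
  by apply/imsetP; exists 0; [exact: chains0 | rewrite boundary0].
move=> /imsetP[c' cC ->] /imsetP[d' dC ->]; apply/imsetP.
by exists (c' + d'); [exact: chainsD | rewrite boundaryD].
Qed.
Canonical boundaries_group (V : finType) (Delta : {set {set V}}) i :=
  Group (boundaries_group_set Delta i).

Definition homology (V : finType) (Delta : {set {set V}}) (i : nat) :=
  (cycles Delta i / boundaries Delta i)%G.

(* [sphere m] triangulates the sphere of dimension [m - 1], as the boundary of
   the simplex on [m + 1] vertices; [sphere 0], whose only face is [set0], is
   the empty sphere of dimension -1. *)
Definition sphere (m : nat) : {set {set 'I_m.+1}} :=
  [set F : {set 'I_m.+1} | F != setT].

(* Homology in every degree isomorphic to that of the [d]-sphere; in particular
   [d >= -1]. A group morphism between Z_2-vector spaces is Z_2-linear. *)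
Definition has_sphere_homology (V : finType) (Delta : {set {set V}}) (d : int) :
    Prop :=
  exists2 m : nat, d = m%:Z - 1
    & forall i : nat, homology Delta i \isog homology (sphere m) i.

(* The polygon has vertices 0, ..., 2n - 1, in cyclic order. *)
Definition vertex (n : nat) := 'I_(2 * n).
Definition segment (n : nat) := {set vertex n}.

Definition crossing (n : nat) (s t : segment n) : bool :=
  [exists a : vertex n, exists b : vertex n,
   exists c : vertex n, exists d : vertex n,
    [&& (a < b)%N, (b < c)%N, (c < d)%N
      & [|| (s == [set a; c]) && (t == [set b; d])
          | (s == [set b; d]) && (t == [set a; c])]]].

Definition has_crossing (n m : nat) (S : {set segment n}) : bool :=
  [exists X : {set segment n},
    [&& X \subset S, #|X| == m
      & [forall s in X, forall t in X, (s != t) ==> crossing s t]]].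

Definition cyclic_length (n : nat) (a b : vertex n) : nat :=
  minn `|a - b|%N (2 * n - `|a - b|)%N.

Definition Omega (n k : nat) : {set segment n} :=
  [set s : segment n | [exists a : vertex n, exists b : vertex n,
    [&& s == [set a; b], a != b & (k < cyclic_length a b)%N]]].

Lemma vertex_gt0 (n : nat) (a : vertex n) : (0 < 2 * n)%N.
Proof. exact: leq_ltn_trans (leq0n a) (ltn_ord a). Qed.

Definition rotate_vertex (n : nat) (a : vertex n) : vertex n :=
  Ordinal (ltn_pmod (a + n) (vertex_gt0 a)).

Definition rotate (n : nat) (s : segment n) : segment n :=
  [set rotate_vertex a | a in s].

(* Rotation by 180 degrees is an involution, so an orbit is {s, rotate s}. *)
Definition rotation_orbit (n : nat) (s : segment n) : {set segment n} :=
  [set s; rotate s].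

Definition orbits (n k : nat) : {set {set segment n}} :=
  [set rotation_orbit s | s in Omega n k].

Definition Dstar (n k : nat) : {set {set {set segment n}}} :=
  [set sigma : {set {set segment n}} |
    (sigma \subset orbits n k) && ~~ has_crossing k.+1 (cover sigma)].

(* Main.v *)
From HB Require Import structures.
Require Import Defs.
From mathcomp Require Import all_boot all_order all_fingroup all_solvable.
From mathcomp Require Import all_algebra.
From mathcomp Require Import zify.

Set Implicit Arguments.
Unset Strict Implicit.
Unset Printing Implicit Defensive.

Import GRing.Theory.
Local Open Scope ring_scope.

(** The complex is a spherical subword complex of type B_(n-k). Lift the
    segments to the strip k < b - a < 2 n - k of the plane; the segment [a, b]
    becomes a comparator acting at time a + b on the positions b - a - k - 1 and
    b - a - k of a word with 2 (n - k) letters, and the half-turn becomes the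
    reflection of the strip, so that orbits are generators of type B. Following
    the partial counts of large letters through the network of the comparators
    outside a set [sigma] of orbits, one finds that they measure longest chains
    of segments of [sigma]; hence the network reverses the identity word exactly
    when [sigma] contains no (k+1)-crossing. So the faces are the sets of letters
    of a word whose complement has Demazure product w0, and a link is a complex of
    the same kind. The link and the deletion of the last letter of a word are
    again subword complexes; by vertex decomposition and induction, a subword
    complex is acyclic if the Demazure product of its word exceeds the target and
    a homology sphere if they agree. *)

(** * Reduced mod 2 homology *)

Section ReducedChains.
Variable V : finType.
Implicit Types (Delta : {set {set V}}) (c d : chain V) (F G : {set V}) (i j : nat).

Lemma chain_addrr c : c + c = 0.
Proof. by apply/ffunP => F; rewrite !ffunE addrr_pchar2 // pchar_Fp. Qed.

Lemma chain_oppr c : - c = c.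
Proof. by apply/eqP; rewrite eq_sym -addr_eq0 chain_addrr. Qed.

Lemma F2_neq0 (x : 'F_2) : x != 0 -> x = 1.
Proof. by case: x => [[|[|]]] // i _; apply/val_inj. Qed.

Definition simplicial Delta :=
  forall F G, F \subset G -> G \in Delta -> F \in Delta.

Definition rboundary c : chain V :=
  [ffun F : {set V} => \sum_(v in ~: F) c (v |: F)].

Fact rboundary_is_zmod_morphism : zmod_morphism rboundary.
Proof.
move=> c d; apply/ffunP => F; rewrite !ffunE -sumrB.
by apply: eq_bigr => v _; rewrite !ffunE.
Qed.
HB.instance Definition _ :=
  GRing.isZmodMorphism.Build (chain V) (chain V) rboundary
    rboundary_is_zmod_morphism.

Lemma rboundary_rboundary c : rboundary (rboundary c) = 0.
Proof.
apply/ffunP => F; rewrite !ffunE.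
under eq_bigr => u _ do rewrite ffunE.
rewrite pair_big_dep /=.
pose distinct (p : V * V) := [&& p.1 \notin F, p.2 \notin F & p.1 != p.2].
pose ordered (p : V * V) := (enum_rank p.1 < enum_rank p.2)%N.
pose term (p : V * V) := c (p.2 |: (p.1 |: F)).
rewrite (eq_bigl distinct); last first.
  case=> u w; rewrite /distinct !inE /= negb_or (eq_sym w u).
  by case: (u \in F); case: (w \in F); case: (u == w).
have flip_inj : injective (fun p : V * V => (p.2, p.1)).
  by move=> [? ?] [? ?] [-> ->].
rewrite (bigID ordered) /= [X in _ + X](reindex_inj flip_inj) /=.
rewrite [X in _ + X](eq_big (fun p => distinct p && ordered p) term).
- by rewrite addrr_pchar2 // pchar_Fp.
- case=> u w; rewrite /distinct /ordered /= -leqNgt leq_eqVlt (inj_eq val_inj).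
  rewrite (inj_eq enum_rank_inj) (eq_sym w u).
  by case: (u \in F); case: (w \in F); case: (u == w); rewrite ?andbF.
- by case=> u w _; rewrite /term /= setUCA.
Qed.

(* Graded by the number of vertices of the faces, so that degree 0 is spanned
   by the empty face. *)
Definition rchain Delta j c := forall F, c F != 0 -> F \in Delta /\ #|F| = j.

Lemma rchain0 Delta j : rchain Delta j 0.
Proof. by move=> F; rewrite ffunE eqxx. Qed.

Lemma rchainD Delta j c d :
  rchain Delta j c -> rchain Delta j d -> rchain Delta j (c + d).
Proof.
move=> cP dP F; rewrite ffunE.
by have [-> | /cP //] := eqVneq (c F) 0; rewrite add0r => /dP.
Qed.

Lemma rchainS Delta Delta' j c :
  Delta \subset Delta' -> rchain Delta j c -> rchain Delta' j c.
Proof. by move=> /subsetP sub cP F /cP[/sub]. Qed.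

Lemma rchain_coef0 Delta j c F :
  rchain Delta j c -> (F \in Delta -> #|F| != j) -> c F = 0.
Proof. by move=> cP Fj; apply/eqP; apply: contraTT isT => /cP[/Fj/eqP]. Qed.

Lemma rchain_rboundary Delta j c :
  simplicial Delta -> rchain Delta j.+1 c -> rchain Delta j (rboundary c).
Proof.
move=> sD cP F; rewrite ffunE => sum_neq0.
have [v /andP[vF cF]|none] := pickP (fun v => (v \notin F) && (c (v |: F) != 0)).
  have [FD] := cP _ cF; rewrite cardsU1 vF => -[Fj].
  by split=> //; exact: sD (subsetUr _ _) FD.
case/eqP: sum_neq0; apply: big1 => v; rewrite inE => vF.
by have := none v; rewrite vF /= => /negbT; rewrite negbK => /eqP.
Qed.

Definition rcycle Delta j c := rchain Delta j c /\ rboundary c = 0.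
Definition rbound Delta j c := exists2 d, rchain Delta j.+1 d & rboundary d = c.

Lemma rcycleD Delta j c d :
  rcycle Delta j c -> rcycle Delta j d -> rcycle Delta j (c + d).
Proof.
by move=> [cP c0] [dP d0]; split; [exact: rchainD | rewrite raddfD /= c0 d0 addr0].
Qed.

Lemma rbound0 Delta j : rbound Delta j 0.
Proof. by exists 0; [exact: rchain0 | exact: raddf0]. Qed.

Definition simplex F : chain V := [ffun G => (G == F)%:R].

Lemma rchain_simplex Delta F : F \in Delta -> rchain Delta #|F| (simplex F).
Proof. by move=> FD G; rewrite ffunE; have [->|_] := eqVneq G F; rewrite ?eqxx. Qed.

Lemma rboundary_simplex0 : rboundary (simplex set0) = 0.
Proof.
apply/ffunP => F; rewrite !ffunE big1 // => v _.
by rewrite ffunE setU_eq0 -cards_eq0 cards1.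
Qed.

Lemma rboundary_simplex1 v : rboundary (simplex [set v]) = simplex set0.
Proof.
apply/ffunP => F; rewrite !ffunE; have [->|F0] := eqVneq F set0.
  rewrite (bigD1 v) ?inE //= ffunE setU0 eqxx big1 ?addr0 // => u /andP[_ uv].
  by rewrite ffunE setU0 (inj_eq set1_inj) (negbTE uv).
rewrite big1 // => u; rewrite inE => uF; rewrite ffunE; case: eqP => // E.
have /eqP := cards1 v; rewrite -E cardsU1 uF add1n eqSS cards_eq0.
by rewrite (negbTE F0).
Qed.

Lemma rchain_degree0 Delta c : rchain Delta 0 c -> c = 0 \/ c = simplex set0.
Proof.
move=> cP; have cF F : F != set0 -> c F = 0.
  by move=> F0; apply: (rchain_coef0 cP); rewrite cards_eq0.
have [c0|/F2_neq0 c0] := eqVneq (c set0) 0; [left|right];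
  apply/ffunP => F; rewrite ffunE.
  by have [->|/cF] := eqVneq F set0.
by have [->|/cF] := eqVneq F set0.
Qed.

Definition acyclic Delta := forall j c, rcycle Delta j c -> rbound Delta j c.

(* [m] is one more than the dimension of the sphere. *)
Definition homology_sphere (m : nat) Delta :=
  [/\ set0 \in Delta,
      forall j c, j != m -> rcycle Delta j c -> rbound Delta j c
    & exists z, [/\ rcycle Delta m z, ~ rbound Delta m z
        & forall c, rcycle Delta m c ->
            rbound Delta m c \/ rbound Delta m (c + z)]].

Lemma homology_sphere_empty : homology_sphere 0 [set set0 : {set V}].
Proof.
have no_chain j c : j != 0%N -> rchain [set set0] j c -> c = 0.
  move=> j0 cP; apply/ffunP => F; rewrite ffunE; apply: (rchain_coef0 cP).
  by rewrite inE => /eqP->; rewrite cards0 eq_sym.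
split; first by rewrite inE.
  by move=> j c j0 [/(no_chain _ _ j0)-> _]; exact: rbound0.
exists (simplex set0); split.
- split; last exact: rboundary_simplex0.
  by rewrite -(cards0 V); apply: rchain_simplex; rewrite inE.
- move=> [d /no_chain->//]; rewrite raddf0 => /ffunP/(_ set0).
  by rewrite !ffunE eqxx => /eqP; rewrite eq_sym oner_eq0.
move=> c [/rchain_degree0[]-> _]; [left | right]; first exact: rbound0.
by rewrite chain_addrr; exact: rbound0.
Qed.

End ReducedChains.

(** * Vertex decompositions *)

Section VertexDecomposition.
Variables (V : finType) (v : V).
Implicit Types (c d : chain V) (F G : {set V}) (i j : nat).

Definition deletion (Delta : {set {set V}}) : {set {set V}} :=
  [set F in Delta | v \notin F].

(* A chain [c] splits as [chain_deletion c + v * chain_link c]. *)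
Definition chain_deletion c : chain V :=
  [ffun F : {set V} => if v \in F then 0 else c F].
Definition chain_link c : chain V :=
  [ffun F : {set V} => if v \in F then 0 else c (v |: F)].
Definition chain_join c d : chain V :=
  [ffun F : {set V} => if v \in F then d (F :\ v) else c F].

Fact chain_link_is_zmod_morphism : zmod_morphism chain_link.
Proof.
move=> c d; apply/ffunP => F; rewrite !ffunE.
by case: ifP => _; rewrite ?subr0 ?ffunE.
Qed.
HB.instance Definition _ :=
  GRing.isZmodMorphism.Build (chain V) (chain V) chain_link
    chain_link_is_zmod_morphism.

Lemma chain_deletion0 : chain_deletion 0 = 0.
Proof. by apply/ffunP => F; rewrite !ffunE if_same. Qed.

Lemma chain_joinE c : chain_join (chain_deletion c) (chain_link c) = c.
Proof.
apply/ffunP => F; rewrite !ffunE; case: (boolP (v \in F)) => // vF.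
by rewrite !inE eqxx /= setD1K.
Qed.

Lemma chain_vertex_eq c d :
  chain_deletion c = chain_deletion d -> chain_link c = chain_link d -> c = d.
Proof. by move=> del lnk; rewrite -[c]chain_joinE del lnk chain_joinE. Qed.

Lemma chain_link_rboundary c : chain_link (rboundary c) = rboundary (chain_link c).
Proof.
apply/ffunP => F; rewrite !ffunE; case: ifP => vF.
  by rewrite big1 // => u _; rewrite ffunE inE vF orbT.
rewrite [RHS](bigID (pred1 v)) /= [X in X + _]big1 ?add0r; last first.
  by move=> u /andP[_ /eqP->]; rewrite ffunE !inE eqxx.
apply: eq_big => [u|u]; first by rewrite !inE negb_or andbC.
rewrite !inE negb_or => /andP[uv uF].
by rewrite ffunE !inE vF orbF eq_sym (negbTE uv) setUCA.
Qed.

Lemma chain_deletion_rboundary c :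
  chain_deletion (rboundary c) = rboundary (chain_deletion c) + chain_link c.
Proof.
apply/ffunP => F; rewrite !ffunE; case: ifP => vF.
  by rewrite addr0 big1 // => u _; rewrite ffunE inE vF orbT.
rewrite (bigD1 v) /= ?inE ?vF // addrC; congr (_ + _).
rewrite [RHS](bigD1 v) /= ?inE ?vF // [X in X + _]ffunE !inE eqxx /= add0r.
apply: eq_bigr => u /andP[_ uv].
by rewrite ffunE !inE vF orbF eq_sym (negbTE uv).
Qed.

Variable Delta : {set {set V}}.
Hypothesis Delta_simplicial : simplicial Delta.
Local Notation Lk := (link Delta [set v]).
Local Notation Del := (deletion Delta).

Lemma mem_link1 F : (F \in Lk) = (v \notin F) && (v |: F \in Delta).
Proof.
rewrite inE setI_eq0 disjoint_sym disjoints1 (setUC F) [X in _ && X]andbC andbCA.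
by congr andb; apply/andb_idl => /(Delta_simplicial (subsetUr _ _)).
Qed.

Lemma link1_sub_deletion : Lk \subset Del.
Proof.
apply/subsetP => F; rewrite mem_link1 inE andbC => /andP[FD ->].
by rewrite (Delta_simplicial _ FD) // subsetUr.
Qed.

Lemma rchain_deletion j c : rchain Delta j c -> rchain Del j (chain_deletion c).
Proof.
move=> cP F; rewrite ffunE.
case: (boolP (v \in F)) => [_|vF /cP[FD Fj]]; first by rewrite eqxx.
by rewrite inE FD.
Qed.

Lemma rchain_link j c : rchain Delta j.+1 c -> rchain Lk j (chain_link c).
Proof.
move=> cP F; rewrite ffunE.
case: (boolP (v \in F)) => [_|vF /cP]; first by rewrite eqxx.
by rewrite mem_link1 vF cardsU1 vF => -[-> []].
Qed.

Lemma rchain_join j c d :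
  rchain Del j.+1 c -> rchain Lk j d -> rchain Delta j.+1 (chain_join c d).
Proof.
move=> cP dP F; rewrite ffunE; case: ifP => vF.
  move=> /dP[]; rewrite mem_link1 setD1K // => /andP[_ FD] Fj.
  by rewrite (cardsD1 v F) vF Fj.
by move=> /cP[]; rewrite inE => /andP[].
Qed.

Lemma chain_deletion_join j c d :
  rchain Del j c -> chain_deletion (chain_join c d) = c.
Proof.
move=> cP; apply/ffunP => F; rewrite !ffunE; case: (boolP (v \in F)) => // vF.
by apply/esym/(rchain_coef0 cP); rewrite inE vF andbF.
Qed.

Lemma chain_link_join j c d : rchain Lk j d -> chain_link (chain_join c d) = d.
Proof.
move=> dP; apply/ffunP => F; rewrite !ffunE; case: (boolP (v \in F)) => vF.
  by apply/esym/(rchain_coef0 dP); rewrite mem_link1 vF.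
by rewrite setU11 setU1K.
Qed.

Lemma rboundary_chain_link j c : rcycle Delta j c -> rboundary (chain_link c) = 0.
Proof. by case=> _ c0; rewrite -chain_link_rboundary c0 raddf0. Qed.

Lemma rboundary_chain_deletion j c :
  rcycle Delta j c -> rboundary (chain_deletion c) = chain_link c.
Proof.
case=> _ c0; have /eqP := chain_deletion_rboundary c.
by rewrite c0 chain_deletion0 eq_sym addr_eq0 chain_oppr => /eqP.
Qed.

Lemma rcycle_chain_link j c : rcycle Delta j.+1 c -> rcycle Lk j (chain_link c).
Proof.
by move=> cP; split; [exact: rchain_link cP.1 | exact: rboundary_chain_link cP].
Qed.

Lemma rbound_join j c d e : rchain Del j.+1 d -> rchain Lk j e ->
  rboundary d + e = chain_deletion c -> rboundary e = chain_link c ->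
  rbound Delta j c.
Proof.
move=> dP eP del lnk; exists (chain_join d e); first exact: rchain_join.
apply: chain_vertex_eq.
  rewrite chain_deletion_rboundary (chain_deletion_join _ dP).
  by rewrite (chain_link_join _ eP).
by rewrite chain_link_rboundary (chain_link_join _ eP).
Qed.

Lemma rbound_of_chain_link j c e : acyclic Del -> rcycle Delta j c ->
  rchain Lk j e -> rboundary e = chain_link c -> rbound Delta j c.
Proof.
move=> acD cP eP eE.
have [|d dP dE] := acD j (chain_deletion c + e).
  split; last by rewrite raddfD /= (rboundary_chain_deletion cP) eE chain_addrr.
  by apply: rchainD (rchain_deletion cP.1) (rchainS link1_sub_deletion eP).
by apply: rbound_join dP eP _ eE; rewrite dE -addrA chain_addrr addr0.
Qed.

Lemma rbound_vertex j c : acyclic Del -> rcycle Delta j c ->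
  (forall i, j = i.+1 -> rbound Lk i (chain_link c)) -> rbound Delta j c.
Proof.
move=> acD; case: j => [|j] cP lnk.
  apply: (rbound_of_chain_link acD cP (rchain0 _ _)).
  rewrite raddf0; apply/esym/ffunP => F; rewrite !ffunE.
  case: ifP => // vF; apply: (rchain_coef0 cP.1) => _.
  by rewrite cards_eq0 setU_eq0 -cards_eq0 cards1.
have [e eP eE] := lnk j erefl; exact: rbound_of_chain_link acD cP eP eE.
Qed.

Lemma acyclic_vertex_decomposition : acyclic Lk -> acyclic Del -> acyclic Delta.
Proof.
move=> acL acD j c cP; apply: (rbound_vertex acD cP) => i ij; apply: acL.
by apply: rcycle_chain_link; rewrite -ij.
Qed.

Lemma acyclic_cone : Lk = Del -> acyclic Delta.
Proof.
move=> cone j c cP.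
apply: (rbound_join (rchain0 _ _) _ _ (rboundary_chain_deletion cP)).
  by rewrite cone; exact: rchain_deletion cP.1.
by rewrite raddf0 add0r.
Qed.

Lemma homology_sphere_vertex_decomposition m :
  homology_sphere m Lk -> acyclic Del -> homology_sphere m.+1 Delta.
Proof.
move=> [L0 acL [z [zP zB zgen]]] acD; split.
- apply: Delta_simplicial (sub0set [set v]) _.
  by move: L0; rewrite mem_link1 setU0 => /andP[].
- move=> j c jm cP; apply: (rbound_vertex acD cP) => i ij; apply: acL.
    by move: jm; rewrite ij eqSS.
  by apply: rcycle_chain_link; rewrite -ij.
have [|e eP eE] := acD m z.
  by split; [exact: rchainS link1_sub_deletion zP.1 | exact: zP.2].
pose Z := chain_join e z; have Z_link : chain_link Z = z := chain_link_join e zP.1.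
have Z_cycle : rcycle Delta m.+1 Z.
  split; first exact: rchain_join eP zP.1.
  apply: chain_vertex_eq; last by rewrite chain_link_rboundary Z_link zP.2 raddf0.
  rewrite chain_deletion_rboundary (chain_deletion_join z eP) Z_link eE.
  by rewrite chain_addrr chain_deletion0.
exists Z; split=> // [[d dP dE]|c cP].
  apply: zB; exists (chain_link d); first exact: rchain_link.
  by rewrite -chain_link_rboundary dE Z_link.
have [cB|cB] := zgen _ (rcycle_chain_link cP); [left|right].
  by apply: (rbound_vertex acD cP) => i [<-].
apply: (rbound_vertex acD (rcycleD cP Z_cycle)) => i [<-].
by rewrite raddfD /= Z_link.
Qed.

End VertexDecomposition.

Section SimplexHomology.
Variable V : finType.
Implicit Types (A B : {set V}) (v : V).

Lemma simplicial_powerset B : simplicial (powerset B).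
Proof. by move=> F G FG; rewrite !inE; exact: subset_trans. Qed.

Lemma simplicial_powersetD1 A : simplicial (powerset A :\ A).
Proof.
move=> F G FG; rewrite !inE => /andP[GA sGA]; rewrite (subset_trans FG sGA) andbT.
by apply: contraNneq GA => FA; rewrite eqEsubset sGA -FA.
Qed.

Lemma setU1_subset v A F : v \in A -> (v |: F \subset A) = (F \subset A).
Proof. by move=> vA; rewrite subUset sub1set vA. Qed.

Lemma acyclic_powerset B : B != set0 -> acyclic (powerset B).
Proof.
case/set0Pn => v vB; apply: (acyclic_cone (v := v) (@simplicial_powerset B)).
apply/setP => F; rewrite (mem_link1 _ (@simplicial_powerset B)) !inE.
by rewrite setU1_subset // andbC.
Qed.

Lemma deletion_simplex_boundary v A : v \in A ->
  deletion v (powerset A :\ A) = powerset (A :\ v).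
Proof.
move=> vA; apply/setP => F; rewrite !inE subsetD1 -andbA.
by apply/andb_idl => /andP[_ vF]; apply: contraNneq vF => ->.
Qed.

Lemma link_simplex_boundary v A : v \in A ->
  link (powerset A :\ A) [set v] = powerset (A :\ v) :\ (A :\ v).
Proof.
move=> vA; apply/setP => F; rewrite (mem_link1 _ (@simplicial_powersetD1 A)) !inE.
rewrite setU1_subset // subsetD1 andbCA (andbC (F \subset A)).
case: (boolP (v \in F)) => vF; rewrite ?andbF //=.
congr (~~ _ && _); apply/eqP/eqP => [<-|->]; first by rewrite setU1K.
exact: setD1K.
Qed.

Lemma homology_sphere_simplex_boundary A m :
  #|A| = m.+1 -> homology_sphere m (powerset A :\ A).
Proof.
elim: m A => [|m IH] A Am.
  have /cards1P[v ->] : #|A| == 1%N by rewrite Am.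
  rewrite (_ : _ :\ _ = [set set0]); first exact: homology_sphere_empty.
  apply/setP => F; rewrite !inE subset1; have [->|] //= := eqVneq F [set v].
  by rewrite -cards_eq0 cards1.
have /set0Pn[v vA] : A != set0 by rewrite -cards_eq0 Am.
have Av : #|A :\ v| = m.+1 by move: Am; rewrite (cardsD1 v A) vA => -[].
apply: (homology_sphere_vertex_decomposition (v := v) (@simplicial_powersetD1 A)).
  by rewrite link_simplex_boundary //; exact: IH.
rewrite deletion_simplex_boundary //; apply: acyclic_powerset.
by rewrite -cards_eq0 Av.
Qed.

End SimplexHomology.

Lemma sphereE m : sphere m = powerset [set: 'I_m.+1] :\ [set: 'I_m.+1].
Proof. by apply/setP => F; rewrite !inE subsetT andbT. Qed.

Lemma homology_sphere_sphere m : homology_sphere m (sphere m).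
Proof.
rewrite sphereE; apply: homology_sphere_simplex_boundary.
by rewrite cardsT card_ord.
Qed.

Lemma simplicial_sphere m : simplicial (sphere m).
Proof. rewrite sphereE; exact: simplicial_powersetD1. Qed.

(** * From reduced to unreduced homology *)

Section Index.
Local Open Scope group_scope.

Lemma index_coset2 (gT : finGroupType) (G H : {group gT}) (x : gT) :
    H \subset G -> x \in G -> x \notin H ->
    (forall y, y \in G -> y \in H \/ y * x \in H) -> #|G : H| = 2%N.
Proof.
move=> sHG xG xH coverG.
have nHx : H != H :* x^-1 :> {set gT}.
  by apply: contraNneq xH => HE; rewrite -groupV HE rcoset_refl.
suff cosets : [set gval H; H :* x^-1] = rcosets H G.
  by rewrite /indexg -cosets cards2 nHx.
apply/setP => K; rewrite !inE; apply/orP/rcosetsP => [[]/eqP->|[y yG ->]].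
- by exists 1; rewrite ?group1 // rcoset1.
- by exists x^-1; rewrite ?groupV.
- have [yH|yxH] := coverG y yG; [left | right]; first by rewrite rcoset_id.
  by apply/eqP/rcoset_eqP; rewrite mem_rcoset invgK.
Qed.

End Index.

Lemma abelem_chain (V : finType) : (2.-abelem [set: chain V])%g.
Proof.
apply/abelemP => //; split; last by move=> c _; exact: chain_addrr.
by apply/centsP => c _ d _; exact: addrC.
Qed.

Lemma abelem_homology (V : finType) (Delta : {set {set V}}) i :
  (2.-abelem (homology Delta i))%g.
Proof. apply/quotient_abelem/abelemS/(abelem_chain V); exact: subsetT. Qed.

Section Homology.
Variables (V : finType) (Delta : {set {set V}}).
Hypothesis Delta_simplicial : simplicial Delta.
Implicit Types (c d : chain V) (F : {set V}).

Lemma chainsP i c : reflect (rchain Delta i.+1 c) (c \in chains Delta i).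
Proof.
rewrite inE; apply: (iffP forallP) => [cP F cF|cP F].
  by move: (cP F); rewrite cF => /andP[-> /eqP].
by apply/implyP => /cP[-> ->]; rewrite eqxx.
Qed.

Lemma boundaryE c F : boundary c F = if F == set0 then 0 else rboundary c F.
Proof. by rewrite !ffunE. Qed.

Lemma boundary_rchain i c : rchain Delta i.+2 c -> boundary c = rboundary c.
Proof.
move=> /(rchain_rboundary Delta_simplicial) dcP.
apply/ffunP => F; rewrite boundaryE.
by case: eqP => // ->; apply/esym/(rchain_coef0 dcP); rewrite cards0.
Qed.

Definition reduced_cycles i : {set chain V} :=
  [set c in chains Delta i | rboundary c == 0].

Lemma reduced_cyclesP i c : reflect (rcycle Delta i.+1 c) (c \in reduced_cycles i).
Proof.
rewrite inE; apply: (iffP andP) => [[/chainsP cP /eqP]|[/chainsP cP c0]] //.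
by rewrite c0.
Qed.

Lemma reduced_cycles_group_set i : group_set (reduced_cycles i).
Proof.
apply/group_setP; split=> [|c d /reduced_cyclesP cP /reduced_cyclesP dP];
  apply/reduced_cyclesP.
  by split; [exact: rchain0 | exact: raddf0].
exact: rcycleD.
Qed.
Canonical reduced_cycles_group i := Group (reduced_cycles_group_set i).

Lemma reduced_cycles_sub i : reduced_cycles i \subset cycles Delta i.
Proof.
apply/subsetP => c; rewrite !in_set => /andP[-> /eqP c0] /=.
by apply/eqP/ffunP => F; rewrite boundaryE c0 ffunE if_same.
Qed.

Lemma boundariesP i c : reflect (rbound Delta i.+1 c) (c \in boundaries Delta i).
Proof.
apply: (iffP imsetP) => [[d /chainsP dP ->]|[d dP <-]]; exists d => //.
- by rewrite (boundary_rchain dP).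
- exact/chainsP.
- by rewrite (boundary_rchain dP).
Qed.

Lemma boundaries_sub_reduced_cycles i : boundaries Delta i \subset reduced_cycles i.
Proof.
apply/subsetP => c /boundariesP[d dP <-]; apply/reduced_cyclesP.
by split; [exact: rchain_rboundary | exact: rboundary_rboundary].
Qed.

Lemma cycles_reduced i : (0 < i)%N -> cycles Delta i = reduced_cycles i.
Proof.
case: i => // i _; apply/setP => c; rewrite [LHS]inE [RHS]inE.
by apply: andb_id2l => /chainsP cP; rewrite (boundary_rchain cP).
Qed.

Lemma index_boundaries_reduced_cycles m i : homology_sphere m Delta ->
  #|reduced_cycles i : boundaries Delta i|%g =
    (if i.+1 == m then 2 else 1)%N.
Proof.
move=> [_ acD [z [zP zB zgen]]]; case: eqP => [im|/eqP im]; last first.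
  apply/eqP; rewrite indexg_eq1; apply/subsetP => c /reduced_cyclesP cP.
  exact/boundariesP/acD.
rewrite -im in zP zB zgen; apply: (index_coset2 (x := z)).
- exact: boundaries_sub_reduced_cycles.
- exact/reduced_cyclesP.
- exact/boundariesP.
by move=> c /reduced_cyclesP /zgen[]/boundariesP cB; [left | right].
Qed.

Lemma homology_sphere0_rchain1_eq0 c :
  homology_sphere 0 Delta -> rchain Delta 1 c -> c = 0.
Proof.
move=> [_ _ [z [[zP _] zB _]]] cP; apply/ffunP => F; rewrite ffunE.
apply: (rchain_coef0 cP) => FD; apply: contra_notN zB => /cards1P[v Fv].
have [->|->] := rchain_degree0 zP; first exact: rbound0.
exists (simplex F); last by rewrite Fv rboundary_simplex1.
by rewrite -(cards1 v) -Fv; exact: rchain_simplex.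
Qed.

Lemma index_reduced_cycles m i : homology_sphere m Delta ->
  #|cycles Delta i : reduced_cycles i|%g =
    (if (i == 0) && (0 < m) then 2 else 1)%N.
Proof.
move=> sph; have [->|i0] := posnP i; last by rewrite cycles_reduced // indexgg.
have [m0|m0] := posnP m.
  apply/eqP; rewrite indexg_eq1; apply/subsetP => c.
  rewrite inE => /andP[/chainsP cP _]; apply/reduced_cyclesP; split=> //.
  by rewrite (@homology_sphere0_rchain1_eq0 c) ?raddf0 //; rewrite -m0.
have [D0 acD _] := sph.
have [||e eP eE] := acD 0%N (simplex set0).
- by rewrite eq_sym -lt0n.
- split; last exact: rboundary_simplex0.
  by rewrite -(cards0 V); exact: rchain_simplex.
apply: (index_coset2 (x := e)); first exact: reduced_cycles_sub.
- rewrite inE; apply/andP; split; first exact/chainsP.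
  by apply/eqP/ffunP => F; rewrite boundaryE eE !ffunE; case: (F == set0).
- apply/reduced_cyclesP => -[_]; rewrite eE => /ffunP/(_ set0).
  by rewrite !ffunE eqxx => /eqP; rewrite oner_eq0.
move=> c; rewrite inE => /andP[/chainsP cP _].
have := rchain_rboundary Delta_simplicial cP.
case/rchain_degree0 => c0; [left; exact/reduced_cyclesP | right].
apply/reduced_cyclesP; split; first exact: rchainD.
by rewrite raddfD /= eE c0 chain_addrr.
Qed.

Lemma card_homology m i : homology_sphere m Delta ->
  #|homology Delta i| =
    ((if (i == 0) && (0 < m) then 2 else 1) * (if i.+1 == m then 2 else 1))%N.
Proof.
move=> sph; rewrite -(index_reduced_cycles i sph).
rewrite -(index_boundaries_reduced_cycles i sph) Lagrange_index.
- rewrite card_quotient //; apply: cents_norm.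
  by apply: (sub_abelian_cent2 (abelem_abelian (abelem_chain V))); exact: subsetT.
- exact: reduced_cycles_sub.
- exact: boundaries_sub_reduced_cycles.
Qed.

End Homology.

Lemma has_sphere_homology_reduced (V : finType) (Delta : {set {set V}}) m :
  simplicial Delta -> homology_sphere m Delta ->
  has_sphere_homology Delta (m%:Z - 1).
Proof.
move=> simD sphD; exists m => // i.
rewrite (isog_abelem_card _ (abelem_homology Delta i)) abelem_homology /=.
rewrite (card_homology simD _ sphD).
by rewrite (card_homology (@simplicial_sphere m) _ (homology_sphere_sphere m)).
Qed.

Local Open Scope nat_scope.

(** * Subword complexes *)

(* The order-theoretic content of the Bruhat order on a Coxeter group with
   generators [S]: [raise s x] and [lower s x] are the larger and the smaller
   of [x] and [x * s]. *)
Record demazure_order (S W : Type) (bruhat : rel W) (raise lower : S -> W -> W)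
    (bot : W) (length : W -> nat) : Prop := DemazureOrder {
  demazure_refl : reflexive bruhat;
  demazure_trans : transitive bruhat;
  demazure_galois : forall s x y, bruhat x (raise s y) = bruhat (lower s x) y;
  demazure_le_raise : forall s x, bruhat x (raise s x);
  demazure_raise_idem : forall s x, bruhat (raise s (raise s x)) (raise s x);
  demazure_lower_or_raise : forall s x,
    bruhat x (lower s x) \/ bruhat (raise s x) x;
  demazure_raise_lowerN : forall s x, ~~ bruhat (raise s x) (lower s x);
  demazure_bot : forall x, bruhat bot x;
  demazure_length_bot : forall x, bruhat x bot -> length x = 0;
  demazure_length_lower : forall s x,
    ~~ bruhat x (lower s x) -> length x = (length (lower s x)).+1 }.

Section Subword.
Variables (V : finType) (S W : Type) (bruhat : rel W) (raise lower : S -> W -> W).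
Variables (bot : W) (length : W -> nat).
Hypothesis W_demazure : demazure_order bruhat raise lower bot length.
Local Notation "x <<= y" := (bruhat x y) (at level 70).
Implicit Types (Q : seq (V * S)) (F G : {set V}) (x y : W) (s : S) (v : V).

Let le_refl : reflexive bruhat := demazure_refl W_demazure.
Let le_trans : transitive bruhat := demazure_trans W_demazure.
Let le_raise : forall s x, x <<= raise s x := demazure_le_raise W_demazure.
Let galois : forall s x y, (x <<= raise s y) = (lower s x <<= y) :=
  demazure_galois W_demazure.

Lemma lower_le s x : lower s x <<= x.
Proof. by rewrite -galois le_raise. Qed.

Lemma raise_mono s x y : x <<= y -> raise s x <<= raise s y.
Proof. by rewrite galois; apply: le_trans; rewrite -galois le_refl. Qed.

Lemma lower_mono s x y : x <<= y -> lower s x <<= lower s y.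
Proof.
by move=> xy; rewrite -galois; apply: le_trans xy _; rewrite galois le_refl.
Qed.

Lemma raise_lowerN s x : raise s x <<= x -> ~~ (x <<= lower s x).
Proof.
by move=> rx; apply: contra (demazure_raise_lowerN W_demazure s x); exact: le_trans.
Qed.

Lemma raise_closed s x y : x <<= raise s y -> raise s y <<= x -> raise s x <<= x.
Proof.
move=> /(raise_mono s) xy; apply: le_trans.
by apply: le_trans xy _; exact: (demazure_raise_idem W_demazure).
Qed.

(* The head of [Q] acts last. *)
Definition demazure Q F : W :=
  foldr (fun p y => if p.1 \in F then y else raise p.2 y) bot Q.

Definition subword Q x : {set {set V}} :=
  [set F : {set V} | (F \subset [set:: unzip1 Q]) && (x <<= demazure Q F)].

Lemma demazure_antimono Q F G : F \subset G -> demazure Q G <<= demazure Q F.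
Proof.
move=> sFG; elim: Q => [|[v s] Q IH] //=; case: (boolP (v \in F)) => vF.
  by rewrite (subsetP sFG _ vF).
by case: ifP => _; [exact: le_trans (le_raise _ _) | exact: raise_mono].
Qed.

Lemma demazure_filter Q F G :
  demazure [seq p <- Q | p.1 \notin G] F = demazure Q (F :|: G).
Proof.
elim: Q => //= -[v s] Q IH /=; rewrite inE; case: (v \in G) => /=.
  by rewrite orbT.
by rewrite orbF IH.
Qed.

Lemma simplicial_subword Q x : simplicial (subword Q x).
Proof.
move=> F G sFG; rewrite !inE => /andP[GQ xG]; rewrite (subset_trans sFG GQ).
exact: le_trans (demazure_antimono Q sFG).
Qed.

Lemma subword_antimono Q x y : x <<= y -> subword Q y \subset subword Q x.
Proof.
by move=> xy; apply/subsetP => F; rewrite !inE => /andP[-> /=]; exact: le_trans.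
Qed.

Lemma link_subword Q x G : G \subset [set:: unzip1 Q] ->
  link (subword Q x) G = subword [seq p <- Q | p.1 \notin G] x.
Proof.
have unzip_Q :
    unzip1 [seq p <- Q | p.1 \notin G] = [seq v <- unzip1 Q | v \notin G].
  by rewrite /unzip1 filter_map.
have set_Q : [set:: unzip1 [seq p <- Q | p.1 \notin G]] = [set:: unzip1 Q] :\: G.
  by apply/setP => v; rewrite unzip_Q !inE mem_filter.
move=> GQ; apply/setP => F.
rewrite [RHS]inE set_Q subsetD demazure_filter inE setI_eq0.
apply/and3P/andP => [[_]|[/andP[FQ FG] xFG]].
  by rewrite inE subUset -andbA => /and3P[-> _ ->] ->.
have FGQ : F :|: G \in subword Q x by rewrite inE subUset FQ GQ.
by split=> //; exact: simplicial_subword (subsetUl F G) FGQ.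
Qed.

Section LastLetter.
Variables (v : V) (s : S) (Q : seq (V * S)).
Hypothesis vQ : v \notin unzip1 Q.

Lemma subword_notin x F : F \in subword Q x -> v \notin F.
Proof.
rewrite inE => /andP[/subsetP FQ _]; apply: contra vQ => /FQ.
by rewrite inE.
Qed.

Lemma link_subword_cons x : link (subword ((v, s) :: Q) x) [set v] = subword Q x.
Proof.
rewrite link_subword; last by rewrite sub1set inE mem_head.
congr (subword _ x); rewrite /= inE eqxx /=; apply/all_filterP.
rewrite -(all_map fst (fun u => u \notin [set v])); apply/allP => u uQ.
by rewrite inE; apply: contraNneq vQ => <-.
Qed.

Lemma deletion_subword_cons x :
  deletion v (subword ((v, s) :: Q) x) = subword Q (lower s x).
Proof.
apply/setP => F; rewrite inE; case: (boolP (v \in F)) => vF.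
  by rewrite andbF; apply/esym/negbTE; apply: contraL vF; exact: subword_notin.
rewrite andbT !inE /= (negbTE vF) galois set_cons; congr andb.
by rewrite -subDset (setDidPl _) // disjoint_sym disjoints1.
Qed.

Lemma subword_cons_notin x : ~~ (x <<= demazure Q set0) ->
  subword ((v, s) :: Q) x = subword Q (lower s x).
Proof.
move=> nxQ; rewrite -deletion_subword_cons; apply/setP => F; rewrite [RHS]inE.
apply/esym/andb_idr; rewrite inE /= => /andP[_]; case: ifP => // _ xF.
by case/negP: nxQ; apply: le_trans xF _; exact: demazure_antimono (sub0set F).
Qed.

End LastLetter.

Theorem acyclic_subword Q x : uniq (unzip1 Q) ->
  ~~ (demazure Q set0 <<= x) -> acyclic (subword Q x).
Proof.
elim: Q x => [|[v s] Q IH] x /=; first by rewrite (demazure_bot W_demazure).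
rewrite inE => /andP[vQ uQ] nQx.
have [xlow|rx] := demazure_lower_or_raise W_demazure s x.
  apply: (acyclic_cone (v := v) (@simplicial_subword _ _)).
  rewrite link_subword_cons // deletion_subword_cons //.
  by apply/eqP; rewrite eqEsubset !subword_antimono ?lower_le.
have nyx : ~~ (demazure Q set0 <<= x).
  by apply: contra nQx => /(raise_mono s) yx; exact: le_trans yx rx.
apply: (acyclic_vertex_decomposition (v := v) (@simplicial_subword _ _)).
  by rewrite link_subword_cons //; exact: IH.
rewrite deletion_subword_cons //; apply: IH => //.
by apply: contra nyx => yx; exact: le_trans yx (lower_le s x).
Qed.

Theorem homology_sphere_subword Q x : uniq (unzip1 Q) ->
    x <<= demazure Q set0 -> demazure Q set0 <<= x ->
  exists2 d, d + length x = size Q & homology_sphere d (subword Q x).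
Proof.
elim: Q x => [|[v s] Q IH] x /=.
  move=> _ xb bx; exists 0; first by rewrite (demazure_length_bot W_demazure).
  rewrite (_ : subword _ _ = [set set0]); first exact: homology_sphere_empty.
  apply/setP => F; rewrite !inE xb andbT -subset0.
  by congr (F \subset _); apply/setP => v; rewrite !inE.
rewrite inE => /andP[vQ uQ]; set y := demazure Q set0 => xry ryx.
have nxlow := raise_lowerN (raise_closed xry ryx).
have yx : y <<= x := le_trans (le_raise s y) ryx.
have [xy|nxy] := boolP (x <<= y).
  have [d dE sph] := IH x uQ xy yx; exists d.+1; first by rewrite -dE.
  apply: (homology_sphere_vertex_decomposition (v := v) (@simplicial_subword _ _)).
    by rewrite link_subword_cons.
  rewrite deletion_subword_cons //; apply: acyclic_subword => //.
  by apply: contra nxlow; exact: le_trans.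
have ylow : y <<= lower s x.
  have [ylow|ry] := demazure_lower_or_raise W_demazure s y.
    exact: le_trans ylow (lower_mono s yx).
  by case/negP: nxy; exact: le_trans ry.
rewrite galois in xry; have [d dE sph] := IH (lower s x) uQ xry ylow.
exists d; last by rewrite subword_cons_notin.
by rewrite (demazure_length_lower W_demazure nxlow) addnS dE.
Qed.

End Subword.

(** * Signed permutations *)

Section Heights.
Implicit Types (x y : nat -> nat) (p q i j r : nat).

Definition height x q i := \sum_(p < i) (q <= x p).

Lemma height0 x q : height x q 0 = 0.
Proof. exact: big_ord0. Qed.

Lemma heightS x q i : height x q i.+1 = height x q i + (q <= x i).
Proof. exact: big_ord_recr. Qed.

Lemma eq_height x y q i :
  (forall p, p < i -> x p = y p) -> height x q i = height y q i.
Proof. by move=> xy; apply: eq_bigr => p _; rewrite xy. Qed.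

Lemma leq_height x q : {homo height x q : i j / i <= j}.
Proof. by apply: homo_leq leqnn leq_trans _ => i; rewrite heightS leq_addr. Qed.

Lemma leq_height_add x q i j : height x q (i + j) <= height x q i + j.
Proof.
elim: j => [|j IH]; rewrite ?addn0 // addnS heightS.
by case: (q <= _); lia.
Qed.

Lemma height_id q i : height id q i = i - q.
Proof. by elim: i => [|i IH]; rewrite ?height0 // heightS IH; lia. Qed.

Definition adjacent r p := if p.+1 == r then r else if p == r then r.-1 else p.

Lemma height_adjacent x q r j : 0 < r ->
  height (x \o adjacent r) q j =
    if j == r then height x q r.-1 + (q <= x r) else height x q j.
Proof.
case: r => // r _; elim: j => [|j IH]; first by rewrite !height0.
rewrite !heightS {}IH /= /adjacent eqSS; have [->|jr] := eqVneq j r.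
  by rewrite eqn_leq ltnn andbF.
by have [->|] := eqVneq j r.+1; rewrite ?heightS //=; lia.
Qed.

Definition inversions x i := \sum_(r < i) height x (x r).+1 r.

Lemma inversionsS x i : inversions x i.+1 = inversions x i + height x (x i).+1 i.
Proof. exact: big_ord_recr. Qed.

Lemma inversions_adjacent x r i : 0 < r < i -> x r < x r.-1 ->
  inversions x i = (inversions (x \o adjacent r) i).+1.
Proof.
case: r => // r /= ri lt_x.
have same p : p != r -> p != r.+1 ->
    height (x \o adjacent r.+1) (x (adjacent r.+1 p)).+1 p = height x (x p).+1 p.
  move=> /negbTE pr /negbTE prS.
  by rewrite height_adjacent // prS /adjacent eqSS pr prS.
have below : inversions (x \o adjacent r.+1) r = inversions x r.
  by apply: eq_bigr => p _; apply: same; have := ltn_ord p; lia.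
elim: i ri => // i IH; rewrite ltnS leq_eqVlt => /predU1P[<-|ri].
  rewrite !inversionsS below !height_adjacent // eqxx ltn_eqF // heightS /=.
  have -> : adjacent r.+1 r = r.+1 by rewrite /adjacent eqxx.
  have -> : adjacent r.+1 r.+1 = r by rewrite /adjacent eqxx (gtn_eqF (ltnSn _)).
  by rewrite lt_x (ltnNge (x r)) (ltnW lt_x) addn0 addn1 addnS addnAC.
rewrite !inversionsS (IH ri) /= same ?addSn //; first by rewrite gtn_eqF // ltnW.
by rewrite gtn_eqF.
Qed.

End Heights.

(* The Coxeter group of type B_m, as the permutations of [0, 2 m) that commute
   with the reflection p |-> 2 m - 1 - p. The values outside [0, 2 m) are junk,
   so that the Bruhat order below is only a preorder. *)
Record signed_perm (m : nat) := SignedPerm {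
  signed_fun :> nat -> nat;
  signed_opp : forall p, p < 2 * m ->
    signed_fun p + signed_fun ((2 * m).-1 - p) = (2 * m).-1;
  signed_inj : forall p r, p < 2 * m -> r < 2 * m ->
    signed_fun p = signed_fun r -> p = r }.

Section SignedPermutations.
Variable m : nat.
Local Notation M := (2 * m).
Implicit Types (x y : signed_perm m) (l : 'I_m) (p q i j r : nat).

Lemma signed_ltn x p : p < M -> x p < M.
Proof. by move=> pM; have := signed_opp x pM; lia. Qed.

Lemma height_signed x q : q <= M -> height x q M = M - q.
Proof.
move=> qM; pose f (p : 'I_M) := Ordinal (signed_ltn x (ltn_ord p)).
have f_inj : injective f.
  by move=> p r /(congr1 val) /= /(signed_inj (ltn_ord p) (ltn_ord r)) /val_inj.
rewrite -(height_id q M) /height [RHS](reindex_inj f_inj).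
exact: eq_bigr.
Qed.

Lemma height_signed_ge x q i : q <= M -> i <= M -> i - q <= height x q i.
Proof.
move=> qM iM; have := leq_height_add x q i (M - i).
by rewrite subnKC // height_signed //; lia.
Qed.

Lemma height_signed_le x q i : q <= M -> i <= M -> height x q i <= minn i (M - q).
Proof.
move=> qM iM; rewrite leq_min -(height_signed x qM) leq_height // andbT.
by have := leq_height_add x q 0 i; rewrite height0.
Qed.

Definition bruhat x y :=
  [forall q : 'I_M.+1, forall i : 'I_M.+1, height x q i <= height y q i].

Lemma bruhatP x y : reflect
  (forall q i, q <= M -> i <= M -> height x q i <= height y q i) (bruhat x y).
Proof.
apply: (iffP forallP) => [xy q i qM iM|xy q].
  by have /forallP/(_ (inord i)) := xy (inord q); rewrite !inordK.
by apply/forallP => i; apply: xy; rewrite -ltnS.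
Qed.

Lemma bruhat_refl : reflexive bruhat.
Proof. by move=> x; apply/bruhatP. Qed.

Lemma bruhat_trans : transitive bruhat.
Proof.
move=> y x z /bruhatP xy /bruhatP yz; apply/bruhatP => q i qM iM.
exact: leq_trans (xy _ _ qM iM) (yz _ _ qM iM).
Qed.

Lemma bruhat_antisym x y : bruhat x y -> bruhat y x -> forall p, p < M -> x p = y p.
Proof.
move=> /bruhatP xy /bruhatP yx p pM.
have same q : q <= M -> (q <= x p) = (q <= y p).
  move=> qM; have := xy q p qM (ltnW pM); have := yx q p qM (ltnW pM).
  have := xy q p.+1 qM pM; have := yx q p.+1 qM pM; rewrite !heightS; lia.
have := same (x p) (ltnW (signed_ltn x pM)).
by have := same (y p) (ltnW (signed_ltn y pM)); lia.
Qed.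

Fact signed_id_opp p : p < M -> p + (M.-1 - p) = M.-1.
Proof. lia. Qed.
Definition signed_id : signed_perm m :=
  @SignedPerm m id signed_id_opp (fun p r _ _ => id).

Fact signed_rev_opp p : p < M -> (M.-1 - p) + (M.-1 - (M.-1 - p)) = M.-1.
Proof. lia. Qed.
Fact signed_rev_inj p r : p < M -> r < M -> M.-1 - p = M.-1 - r -> p = r.
Proof. lia. Qed.
Definition signed_rev : signed_perm m := SignedPerm signed_rev_opp signed_rev_inj.

Lemma height_rev q i : i <= M -> height signed_rev q i = minn i (M - q).
Proof.
elim: i => [|i IH] iM; first by rewrite height0 min0n.
by rewrite heightS IH /=; lia.
Qed.

Lemma bruhat_id x : bruhat signed_id x.
Proof.
by apply/bruhatP => q i qM iM; rewrite height_id; exact: height_signed_ge.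
Qed.

Lemma bruhat_rev x : bruhat x signed_rev.
Proof.
by apply/bruhatP => q i qM iM; rewrite height_rev //; exact: height_signed_le.
Qed.

(* The generator [l] exchanges [l] with [l.+1] and [M - l.+2] with [M - l.+1];
   these are the same two points when [l.+1 = m]. *)
Definition swap l : nat -> nat :=
  if l.+1 == m then adjacent m else adjacent l.+1 \o adjacent (M - l.+1).

Definition moved l j := (j == l.+1) || (j == M - l.+1).

Lemma movedP l j :
  moved l j -> [/\ 0 < j, j < M, ~~ moved l j.-1 & ~~ moved l j.+1].
Proof. by have := ltn_ord l; rewrite /moved; split; lia. Qed.

Lemma height_swap (x : nat -> nat) l q j :
  height (x \o swap l) q j =
    if moved l j then height x q j.-1 + (q <= x j) else height x q j.
Proof.
have lm := ltn_ord l; rewrite /swap /moved; case: eqP => lE.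
  have -> : M - l.+1 = m by lia.
  rewrite lE orbb height_adjacent; last by lia.
  by case: eqP => // ->.
have pred_neq : ((M - l.+1).-1 == l.+1) = false by lia.
have succ_neq : ((M - l.+1).+1 == l.+1) = false by lia.
have neq : (M - l.+1 == l.+1) = false by lia.
rewrite -[x \o _]/((x \o adjacent l.+1) \o adjacent (M - l.+1)).
rewrite height_adjacent; last by lia.
rewrite !height_adjacent //=; have [->|jM] := eqVneq j (M - l.+1).
  by rewrite orbT pred_neq /adjacent succ_neq neq.
by rewrite orbF; case: eqP => // ->.
Qed.

Lemma swapE l p :
  swap l p = if moved l p.+1 then p.+1 else if moved l p then p.-1 else p.
Proof.
have := ltn_ord l; rewrite /swap /moved; case: eqP => /= lE; rewrite /adjacent.
  by do ?case: ifP; lia.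
by do ?case: ifP; lia.
Qed.

Lemma swap_ltn l p : p < M -> swap l p < M.
Proof. by have := ltn_ord l; rewrite swapE /moved; do ?case: ifP; lia. Qed.

Lemma swapK l p : p < M -> swap l (swap l p) = p.
Proof.
have := ltn_ord l; rewrite (swapE l p) /moved; case: ifP; last case: ifP;
  by rewrite swapE /moved; do ?case: ifP; lia.
Qed.

Lemma swap_opp l p : p < M -> swap l (M.-1 - p) = M.-1 - swap l p.
Proof. by have := ltn_ord l; rewrite !swapE /moved; do ?case: ifP; lia. Qed.

Fact signed_swap_opp l x p :
  p < M -> (x \o swap l) p + (x \o swap l) (M.-1 - p) = M.-1.
Proof. by move=> pM; rewrite /= swap_opp // signed_opp // swap_ltn. Qed.
Fact signed_swap_inj l x p r :
  p < M -> r < M -> (x \o swap l) p = (x \o swap l) r -> p = r.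
Proof.
move=> pM rM /= /signed_inj E; rewrite -(swapK l pM) E ?swapK //; exact: swap_ltn.
Qed.
Definition signed_swap l x : signed_perm m :=
  SignedPerm (@signed_swap_opp l x) (@signed_swap_inj l x).

Definition raise l x := if x l < x l.+1 then signed_swap l x else x.
Definition lower l x := if x l.+1 < x l then signed_swap l x else x.

Lemma moved_neq l x j : moved l j -> x j.-1 != x j.
Proof.
case/movedP=> j0 jM _ _; apply/eqP => /signed_inj; lia.
Qed.

Lemma moved_ltn l x j : moved l j -> (x j.-1 < x j) = (x l < x l.+1).
Proof.
have lm := ltn_ord l; case/orP=> /eqP-> //.
have lM : l < M by lia.
have lM' : l.+1 < M by lia.
have oppl : M.-1 - l = M - l.+1 by lia.
have oppl' : M.-1 - l.+1 = (M - l.+1).-1 by lia.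
have := signed_opp x lM; have := signed_opp x lM'; rewrite {}oppl {}oppl'.
by move: (x _) (x _) (x _) (x _) => *; lia.
Qed.

Lemma moved_gtn l x j : moved l j -> (x j < x j.-1) = (x l.+1 < x l).
Proof.
have flip p : moved l p -> (x p < x p.-1) = ~~ (x p.-1 < x p).
  by move=> mp; rewrite -leqNgt [RHS]leq_eqVlt eq_sym (negbTE (moved_neq x mp)).
have ml : moved l l.+1 by rewrite /moved eqxx.
by move=> mj; rewrite (flip j mj) (moved_ltn x mj) -(flip _ ml).
Qed.

Lemma height_raise l x q j :
  height (raise l x) q j =
    if moved l j then minn (height x q j.-1).+1 (height x q j.+1) else height x q j.
Proof.
have -> : height (raise l x) q j =
    if x l < x l.+1 then height (x \o swap l) q j else height x q j.
  by rewrite /raise; case: ifP.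
rewrite height_swap; case: (boolP (moved l j)) => mj; last by rewrite if_same.
have := moved_neq x mj; rewrite -(moved_ltn x mj); case/movedP: mj.
by case: j => // j _ _ _ _ /=; rewrite !heightS; case: ifP; lia.
Qed.

Lemma height_lower l x q j :
  height (lower l x) q j =
    if moved l j then maxn (height x q j.-1) (height x q j.+1).-1 else height x q j.
Proof.
have -> : height (lower l x) q j =
    if x l.+1 < x l then height (x \o swap l) q j else height x q j.
  by rewrite /lower; case: ifP.
rewrite height_swap; case: (boolP (moved l j)) => mj; last by rewrite if_same.
have := moved_neq x mj; rewrite -(moved_gtn x mj); case/movedP: mj.
by case: j => // j _ _ _ _ /=; rewrite !heightS; case: ifP; lia.
Qed.

(* Both sides say that x <= y holds in all rows of heights not moved by [l]. *)
Lemma bruhat_raise_lower l x y : bruhat x (raise l y) = bruhat (lower l x) y.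
Proof.
apply/bruhatP/bruhatP => xy q j qM jM; have := xy q j qM jM.
  rewrite height_lower height_raise; case: ifP => // mj _.
  have [j0 jM' /negbTE pred /negbTE succ] := movedP mj.
  have := xy q j.-1 qM; have := xy q j.+1 qM; rewrite !height_raise pred succ.
  by case: j {xy mj pred succ jM} j0 jM' => // j _ jM /=; rewrite !heightS; lia.
rewrite height_lower height_raise; case: ifP => // mj _.
have [j0 jM' /negbTE pred /negbTE succ] := movedP mj.
have := xy q j.-1 qM; have := xy q j.+1 qM; rewrite !height_lower pred succ.
by case: j {xy mj pred succ jM} j0 jM' => // j _ jM /=; rewrite !heightS; lia.
Qed.

Lemma bruhat_raise l x : bruhat x (raise l x).
Proof.
apply/bruhatP => q j _ _; rewrite height_raise; case: ifP => // /movedP[].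
by case: j => // j _ _ _ _ /=; rewrite !heightS; lia.
Qed.

Lemma bruhat_raise_idem l x : bruhat (raise l (raise l x)) (raise l x).
Proof.
apply/bruhatP => q j _ _; rewrite height_raise !(height_raise l x).
by case: (boolP (moved l j)) => // /movedP[_ _ /negbTE-> /negbTE->].
Qed.

Lemma bruhat_lower_or_raise l x : bruhat x (lower l x) \/ bruhat (raise l x) x.
Proof.
case: (ltnP (x l) (x l.+1)) => asc; [left|right].
  by rewrite /lower ltnNge (ltnW asc) bruhat_refl.
by rewrite /raise ltnNge asc bruhat_refl.
Qed.

Lemma bruhat_raise_lowerN l x : ~~ bruhat (raise l x) (lower l x).
Proof.
have lm := ltn_ord l; have ml : moved l l.+1 by rewrite /moved eqxx.
have lM : l < M by lia.
have lM' : l.+1 < M by lia.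
have maxM : maxn (x l) (x l.+1) <= M.
  by rewrite geq_max (ltnW (signed_ltn x lM)) (ltnW (signed_ltn x lM')).
have one : (maxn (x l) (x l.+1) <= x l) + (maxn (x l) (x l.+1) <= x l.+1) = 1.
  by have := moved_neq x ml; rewrite !geq_max !leqnn andbT /=; case: ltngtP.
apply/negP => /bruhatP/(_ _ l.+1 maxM (ltnW lM')).
rewrite height_raise height_lower ml /= !heightS -addnA one.
by rewrite addn1 minnn maxnn ltnn.
Qed.

(* Generators whose rows have the same parity move disjoint rows of heights. *)
Lemma height_raise_parity (L : seq 'I_m) x q j :
  {in L &, forall l l' : 'I_m, ~~ odd (l + l')} ->
  height (foldr raise x L) q j =
    if has (fun l => moved l j) L then minn (height x q j.-1).+1 (height x q j.+1)
    else height x q j.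
Proof.
elim: L j => //= l L IH j parity.
have {}IH i : height (foldr raise x L) q i =
    if has (fun l => moved l i) L then minn (height x q i.-1).+1 (height x q i.+1)
    else height x q i.
  by apply: IH => u w uL wL; apply: parity; rewrite inE ?uL ?wL orbT.
rewrite height_raise; case: (boolP (moved l j)) => [mj|_] /=; last exact: IH.
have still i : odd (i + j) -> has (fun l' => moved l' i) L = false.
  move=> ij; apply/negbTE/hasPn => l' l'L.
  have := parity l l' (mem_head _ _); rewrite inE l'L orbT => /(_ isT).
  by have := ltn_ord l; have := ltn_ord l'; move: mj; rewrite /moved; lia.
by have [j0 _ _ _] := movedP mj; rewrite !IH !still //; lia.
Qed.

(* A generator changes this sum by 2: the one with [l.+1 = m] by one inversion
   and one large value in the left half, the other ones by two inversions. *)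
Definition signed_length x := (inversions x M + height x m m)./2.

Lemma eq_signed_length x y :
  (forall p, p < M -> x p = y p) -> signed_length x = signed_length y.
Proof.
move=> xy; rewrite /signed_length; congr (_ + _)./2; last first.
  by apply: eq_height => p pm; apply: xy; lia.
apply: eq_bigr => r _; rewrite xy //.
by apply: eq_height => p pr; apply: xy; exact: ltn_trans pr _.
Qed.

Lemma signed_length_id : signed_length signed_id = 0.
Proof.
rewrite /signed_length height_id subnn addn0 /inversions big1 // => r _.
by rewrite height_id subnS subnn.
Qed.

Lemma signed_length_rev : signed_length signed_rev = m * m.
Proof.
rewrite /signed_length height_rev; last lia.
have -> : inversions signed_rev M = \sum_(0 <= r < M) r.
  rewrite big_mkord; apply: eq_bigr => r _; rewrite height_rev; last exact: ltnW.
  by have := ltn_ord r; rewrite /=; lia.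
have -> : minn m (M - m) = m by lia.
rewrite bin2_sum bin2 -mulnA mul2n doubleK -mulnSr; case: m => // m'.
by rewrite prednK // mulnCA mul2n doubleK.
Qed.

Lemma signed_length_lower l x : ~~ bruhat x (lower l x) ->
  signed_length x = (signed_length (lower l x)).+1.
Proof.
have lm := ltn_ord l; rewrite /lower.
case: ifP => [desc _|_]; last by rewrite bruhat_refl.
rewrite /signed_length height_swap /= /swap; case: eqP => lE.
  have mm : moved l m by rewrite /moved lE eqxx.
  have desc_m : x m < x m.-1 by rewrite (moved_gtn x mm).
  have mM : m < M by lia.
  have refl_m : M.-1 - m = m.-1 by lia.
  have /andP[/ltn_geF lt_m le_m] : x m < m <= x m.-1.
    by have := signed_opp x mM; rewrite refl_m; lia.
  have height_m : height x m m = (height x m m.-1).+1.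
    by have := heightS x m m.-1; rewrite (ltn_predK lm) le_m addn1.
  rewrite mm lt_m height_m (@inversions_adjacent x m) //; last by lia.
  by rewrite addn0 addSnnS !addnS.
have moved_sym : moved l (M - l.+1) by rewrite /moved eqxx orbT.
have desc_sym : x (M - l.+1) < x (M - l.+1).-1 by rewrite (moved_gtn x moved_sym).
have -> : moved l m = false by rewrite /moved; lia.
rewrite (@inversions_adjacent x l.+1) //; last by lia.
rewrite (@inversions_adjacent (x \o _) (M - l.+1)) //; first by lia.
rewrite /= /adjacent; do ?case: eqP; lia.
Qed.

Lemma demazure_signed : demazure_order bruhat raise lower signed_id signed_length.
Proof.
split; [exact: bruhat_refl | exact: bruhat_trans | exact: bruhat_raise_lower
  | exact: bruhat_raise | exact: bruhat_raise_idem | exact: bruhat_lower_or_raise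
  | exact: bruhat_raise_lowerN | exact: bruhat_id | | exact: signed_length_lower].
move=> x /bruhat_antisym/(_ (bruhat_id x))/eq_signed_length->.
exact: signed_length_id.
Qed.

End SignedPermutations.

(** * Heights in a sorting network *)

Definition lt_pair (p r : nat * nat) := (p.1 < r.1) && (p.2 < r.2).

Section PairChains.
Implicit Types (p r : nat * nat) (c : seq (nat * nat)).

Lemma lt_pair_chain_size p c : pairwise lt_pair (p :: c) ->
  p.1 + size c <= (last p c).1 /\ p.2 + size c <= (last p c).2.
Proof.
elim: c p => [|r c IH] p; first by rewrite !addn0.
rewrite pairwise_cons => /andP[/= /andP[lt_pr _] /IH].
by move: lt_pr; rewrite /lt_pair; lia.
Qed.

Lemma lt_pair_chain_bounds p c r : pairwise lt_pair (p :: c) -> r \in p :: c ->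
  (p.1 <= r.1 <= (last p c).1) && (p.2 <= r.2 <= (last p c).2).
Proof.
move=> lt_c rc; have /andP[lo1 lo2] : (p.1 <= r.1) && (p.2 <= r.2).
  move: lt_c rc; rewrite pairwise_cons inE => /andP[/allP lt_first _].
  by case/predU1P=> [->|/lt_first/andP[/ltnW-> /ltnW->]//]; rewrite !leqnn.
have /andP[hi1 hi2] : (r.1 <= (last p c).1) && (r.2 <= (last p c).2).
  move: lt_c rc; rewrite lastI pairwise_rcons mem_rcons inE.
  move=> /andP[/allP lt_last _].
  by case/predU1P=> [->|/lt_last/andP[/ltnW-> /ltnW->]//]; rewrite !leqnn.
by rewrite lo1 hi1 lo2 hi2.
Qed.

End PairChains.

Section BoxChains.
Variable A : pred (nat * nat).
Implicit Types (a b e : nat) (p : nat * nat) (c : seq (nat * nat)).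

Definition in_box a0 b0 a b p := [&& a0 < p.1, p.1 <= a, b0 < p.2 & p.2 <= b].

Definition box_chain a0 b0 a b c :=
  pairwise lt_pair c && all (fun p => in_box a0 b0 a b p && A p) c.

Lemma box_chain_widen a0 b0 a b a' b' c :
  a <= a' -> b <= b' -> box_chain a0 b0 a b c -> box_chain a0 b0 a' b' c.
Proof.
move=> aa bb /andP[lt_c in_c]; rewrite /box_chain lt_c; apply: sub_all in_c => p.
rewrite /in_box => /andP[/and4P[-> pa -> pb] ->].
by rewrite (leq_trans pa aa) (leq_trans pb bb).
Qed.

Lemma box_chain_rcons a0 b0 a b c : a0 <= a -> b0 <= b -> A (a.+1, b.+1) ->
  box_chain a0 b0 a b c -> box_chain a0 b0 a.+1 b.+1 (rcons c (a.+1, b.+1)).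
Proof.
move=> aa bb Aab chain_c.
have /andP[lt_c in_c] := box_chain_widen (leqnSn a) (leqnSn b) chain_c.
rewrite /box_chain pairwise_rcons all_rcons lt_c in_c /in_box /= !ltnS aa bb.
rewrite !leqnn Aab !andbT; case/andP: chain_c => _; apply: sub_all => p.
by rewrite /in_box /lt_pair !ltnS => /andP[/and4P[_ -> _ ->]].
Qed.

Lemma box_chain_cons a0 b0 a b p c : box_chain a0 b0 a b (p :: c) ->
  [/\ in_box a0 b0 a b p, A p & box_chain p.1 p.2 a b c].
Proof.
rewrite /box_chain /= => /andP[/andP[/allP lt_p lt_c]].
move=> /andP[/andP[box_p Ap] /allP in_c]; split=> //; rewrite lt_c.
apply/allP => r rc; have := in_c r rc; have := lt_p r rc.
by rewrite /in_box /lt_pair => /andP[-> ->] /andP[/and4P[_ -> _ ->]].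
Qed.

Lemma box_chain_take a0 b0 a b e c :
  box_chain a0 b0 a b c -> box_chain a0 b0 (a - e) (b - e) (take (size c - e) c).
Proof.
elim/last_ind: c a b e => [|c p IH] a b [|e]; rewrite ?subn0 ?take_size //.
rewrite size_rcons subSS -cats1 takel_cat ?leq_subr // cats1 !subnS !predn_sub.
rewrite {1}/box_chain pairwise_rcons all_rcons.
move=> /andP[/andP[/allP lt_p lt_c] /andP[/andP[box_p _] /allP in_c]]; apply: IH.
rewrite /box_chain lt_c; apply/allP => r rc; have := in_c r rc; have := lt_p r rc.
by move: box_p; rewrite /in_box /lt_pair; case: (A r) => //; lia.
Qed.

Lemma box_chain_prefix a0 b0 a b i c :
  box_chain a0 b0 a b c -> box_chain a0 b0 a b (take i c).
Proof.
rewrite /box_chain -{1 2}(cat_take_drop i c) pairwise_cat all_cat.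
by case/andP=> /and3P[_ -> _] /andP[-> _].
Qed.

End BoxChains.

Section Network.
Variables (n k : nat) (A : pred (nat * nat)).
Local Notation N := (2 * n).
Local Notation M := (2 * (n - k)).
Hypothesis k_ltn : k < n.

(* The number [h t i] of letters at least [q] among the first [i] ones at time
   [t], when the letters [0, ..., M - 1] are sorted by the segments [a, b] with
   k < b - a < 2 n - k outside [A]: at time a + b, such a segment compares the
   positions b - a - k - 1 and b - a - k. Times are shifted by [2 N], so that
   coordinates are nonnegative. *)
Record network_heights (q : nat) (h : nat -> nat -> nat) : Prop := NetworkHeights {
  heights_init : forall i, i <= M -> h 0 i = i - q;
  heights_bottom : forall t, h t 0 = 0;
  heights_top : forall t, h t M = M - q;
  heights_homo : forall t, {homo h t : i j / i <= j};
  heights_add : forall t i j, h t (i + j) <= h t i + j;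
  heights_idle : forall t i a, 2 * a + i + k + 1 = 2 * N + t -> h t.+1 i = h t i;
  heights_step : forall t i a, 0 < i < M -> 2 * a + i + k = 2 * N + t ->
    h t.+1 i = if A (a, a + i + k) then h t i else minn (h t i.-1).+1 (h t i.+1) }.

(* The position [i] was last updated before time [t] by the segment [a, b]. *)
Definition node t i a b :=
  b = a + i + k /\ (a + b + 1 = 2 * N + t \/ a + b + 2 = 2 * N + t).

Definition in_strip (p : nat * nat) :=
  [&& p.1 + k < p.2, p.2 < p.1 + (M + k), 2 * N <= p.1 + p.2 & p.1 + p.2 < 3 * N].

Section Threshold.
Variables (q : nat) (h : nat -> nat -> nat).
Hypothesis h_heights : network_heights q h.

Lemma leq_heights_step t i a : 0 < i < M -> 2 * a + i + k = 2 * N + t ->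
  h t.+1 i <= minn (h t i.-1).+1 (h t i.+1).
Proof.
move=> iM Ea; rewrite (heights_step h_heights iM Ea); case: ifP => // _.
rewrite leq_min (heights_homo h_heights) // andbT.
by have := heights_add h_heights t i.-1 1; rewrite !addn1 prednK //; case/andP: iM.
Qed.

(* The chain [c] accounts for the value [v] of a height at a node [a, b] traced
   back to an initial node: heights count the unit steps of [b] minus the length
   of a chain of segments of [A]. *)
Definition traced v a b := exists a0 b0 i0 c,
  [/\ node 0 i0 a0 b0, [&& i0 <= M, a0 <= a & b0 <= b],
      v + size c + b0 = (i0 - q) + b & box_chain A a0 b0 a b c].

Lemma traced_initial i a b : i <= M -> node 0 i a b -> traced (i - q) a b.
Proof.
by move=> iM nd; exists a, b, i, [::]; split; rewrite ?iM ?leqnn ?addn0.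
Qed.

Lemma traced_stepl v a b : traced v a b -> traced v a.+1 b.
Proof.
move=> [a0 [b0 [i0 [c [nd le vE ch]]]]]; exists a0, b0, i0, c.
by split=> //; [lia | exact: box_chain_widen ch].
Qed.

Lemma traced_stepr v a b : traced v a b -> traced v.+1 a b.+1.
Proof.
move=> [a0 [b0 [i0 [c [nd le vE ch]]]]]; exists a0, b0, i0, c.
by split=> //; [lia | lia | exact: box_chain_widen ch].
Qed.

Lemma traced_chain v a b : A (a.+1, b.+1) -> traced v a b -> traced v a.+1 b.+1.
Proof.
move=> Aab [a0 [b0 [i0 [c [nd /and3P[i0M aa bb] vE ch]]]]].
exists a0, b0, i0, (rcons c (a.+1, b.+1)); rewrite size_rcons.
by split=> //; [lia | lia | exact: box_chain_rcons].
Qed.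

Lemma heights_traced t i a b : i <= M -> node t i a b -> h t i < minn i (M - q) ->
  traced (h t i) a b.
Proof.
elim: t i a b => [|t IH] i a b iM nd low.
  by rewrite (heights_init h_heights) //; exact: traced_initial.
case: (nd) => bE [fresh|idle]; last first.
  have Ea : 2 * a + i + k + 1 = 2 * N + t by lia.
  move: low; rewrite (heights_idle h_heights Ea) => low.
  by apply: IH low => //; split=> //; lia.
have i0 : 0 < i by case: (i) low => //; rewrite min0n.
have iltM : i < M.
  rewrite ltn_neqAle iM andbT; apply: contraTneq low => ->.
  by rewrite (heights_top h_heights) -leqNgt geq_minr.
have Ea : 2 * a + i + k = 2 * N + t by lia.
case: a b bE fresh Ea {nd} => [|a] [|b] bE fresh Ea; try lia.
move: low; rewrite (heights_step h_heights _ Ea) ?i0 // -bE.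
case: ifP => [Aab low | _].
  by apply/traced_chain/IH => //; split; lia.
case: (leqP (h t i.-1).+1 (h t i.+1)) => _ low.
  by apply/traced_stepr/IH; [lia | split; lia | lia].
by apply/traced_stepl/IH; [lia | split; lia | lia].
Qed.

Lemma low_height_box_chain : q <= M -> h N (M - q) < M - q ->
  exists a0 b0 c, size c = k.+1 /\ box_chain A a0 b0 b0 (a0 + N) c.
Proof.
move=> qM low; pose a := (3 * N - (M - q) - k - 1) %/ 2; pose b := a + (M - q) + k.
have nd : node N (M - q) a b by rewrite /node /b /a; split=> //; lia.
have [||a0 [b0 [i0 [c [[b0E b0t] /and3P[i0M aa bb] vE ch]]]]] :=
  heights_traced _ nd.
- exact: leq_subr.
- by rewrite minnn.
pose e := maxn (a - b0) (b - (a0 + N)).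
have size_c : k.+1 <= size c - e by case: nd => bE bt; rewrite /e; lia.
exists a0, b0, (take k.+1 (take (size c - e) c)); split.
  by rewrite size_takel // size_take; case: ifP => //; lia.
by apply/box_chain_prefix/(box_chain_widen _ _ (box_chain_take e ch));
  rewrite /e; lia.
Qed.

Lemma heights_node_same_time t i a b i' a' b' :
    node t i a b -> node t i' a' b' -> a <= a' -> b <= b' ->
  h t i' + b <= h t i + b'.
Proof.
move=> [bE bt] [bE' bt'] aa bb; case: (leqP i i') => ii.
  by have := heights_add h_heights t i (i' - i); rewrite subnKC //; lia.
by have := heights_homo h_heights t (ltnW ii); lia.
Qed.

Lemma heights_node_le t i a b t' i' a' b' :
    node t i a b -> node t' i' a' b' -> i <= M -> i' <= M -> t <= t' ->
    a <= a' -> b <= b' ->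
  h t' i' + b <= h t i + b'.
Proof.
move=> nd nd' iM; elim: t' i' a' b' nd' => [|t' IH] i' a' b' nd' i'M.
  by rewrite leqn0 => /eqP tE; rewrite tE in nd *; exact: heights_node_same_time.
rewrite leq_eqVlt => /predU1P[tE|].
  by rewrite tE in nd *; exact: heights_node_same_time.
rewrite ltnS => tt' aa bb; case: (nd) (nd') => bE bt [bE' [fresh|idle]]; last first.
  have Ea : 2 * a' + i' + k + 1 = 2 * N + t' by lia.
  by rewrite (heights_idle h_heights Ea); apply: (IH i' a' b') => //; split; lia.
have [i0|i0] := posnP i'; first by rewrite i0 (heights_bottom h_heights); lia.
move: i'M; rewrite leq_eqVlt => /predU1P[i'E|i'M].
  rewrite i'E (heights_top h_heights) -(heights_top h_heights t).
  by have := heights_add h_heights t i (M - i); rewrite subnKC //; lia.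
have Ea : 2 * a' + i' + k = 2 * N + t' by lia.
have := leq_heights_step _ Ea; rewrite i0 i'M leq_min => /(_ isT)/andP[stepr stepl].
case: (ltngtP a a') aa => // [aa|aE] _.
  have nd2 : node t' i'.+1 a'.-1 b' by split; lia.
  by have := IH _ _ _ nd2; lia.
have nd2 : node t' i'.-1 a' b'.-1 by split; lia.
by have := IH _ _ _ nd2; lia.
Qed.

Lemma heights_chain_le c t i a b i' a' b' :
    node t i a b -> node N i' a' b' -> i <= M -> i' <= M -> t <= N ->
    a <= a' -> b <= b' -> box_chain A a b a' b' c -> all in_strip c ->
  h N i' + size c + b <= h t i + b'.
Proof.
move=> nd nd' + i'M; elim: c t i a b nd => [|[a1 b1] c IH] t i a b nd iM tN aa bb.
  by move=> _ _; rewrite addn0; exact: heights_node_le nd nd' _ _ _ _ _.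
move=> /box_chain_cons[box1 A1 ch] /= /andP[strip1 strip_c].
move: box1 strip1; rewrite /in_box /in_strip /= => box1 strip1.
pose t1 := a1 + b1 - 2 * N; pose i1 := b1 - a1 - k.
have t1N : t1 < N by rewrite /t1; lia.
have i1M : 0 < i1 < M by rewrite /i1; lia.
have fresh : node t1.+1 i1 a1 b1.
  by split; [rewrite /i1; lia | left; rewrite /t1; lia].
have before : node t1 i1 a1.-1 b1.-1.
  by split; [rewrite /i1; lia | right; rewrite /t1; lia].
have Ea : 2 * a1 + i1 + k = 2 * N + t1 by rewrite /i1 /t1; lia.
have same : h t1.+1 i1 = h t1 i1.
  have b1E : a1 + i1 + k = b1 by rewrite /i1; lia.
  by rewrite (heights_step h_heights i1M Ea) b1E A1.
have tail := IH _ _ _ _ fresh _ t1N _ _ ch strip_c.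
have start := heights_node_le nd before iM.
by case: nd start tail => _ bt; rewrite same /t1; lia.
Qed.

Lemma box_chain_low_height a0 b0 c : node 0 q a0 b0 -> q <= M ->
    size c = k.+1 -> box_chain A a0 b0 b0 (a0 + N) c -> all in_strip c ->
  h N (M - q) < M - q.
Proof.
move=> nd qM size_c ch strip_c.
have nd' : node N (M - q) b0 (a0 + N) by case: nd => bE bt; split; lia.
have [bE bt] := nd.
have := heights_chain_le nd nd' qM (leq_subr _ _) (leq0n _) _ _ ch strip_c.
by rewrite (heights_init h_heights) // subnn size_c; lia.
Qed.

End Threshold.
End Network.

(** * Chords of the polygon and their lifts to the strip *)

Lemma eq_modn_lt3 N a c : a = c %[mod N] -> a < 3 * N -> c < 3 * N ->
  a = c \/ a = c + N \/ c = a + N \/ a = c + 2 * N \/ c = a + 2 * N.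
Proof.
move=> E aN cN; have N0 : 0 < N by lia.
have := divn_eq a N; have := divn_eq c N; rewrite E.
have : c %/ N < 3 by rewrite ltn_divLR.
have : a %/ N < 3 by rewrite ltn_divLR.
move: (c %% N) => r.
by case: (a %/ N) => [|[|[|]]] //; case: (c %/ N) => [|[|[|]]] //; lia.
Qed.

Section Polygon.
Variable n : nat.
Local Notation N := (2 * n).
Hypothesis N_gt0 : 0 < N.
Implicit Types (a b c d : nat) (p r : nat * nat) (s t : segment n).

Definition vtx a : vertex n := Ordinal (ltn_pmod a N_gt0).
Definition chord a b : segment n := [set vtx a; vtx b].

Lemma vtx_ord (v : vertex n) : vtx v = v.
Proof. by apply: val_inj; rewrite /= modn_small. Qed.

Lemma chordC a b : chord a b = chord b a.
Proof. exact: setUC. Qed.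

Lemma eq_chord a b c d : a = c %[mod N] -> b = d %[mod N] -> chord a b = chord c d.
Proof.
have eq_vtx i j : i = j %[mod N] -> vtx i = vtx j by move=> ij; apply: val_inj.
by rewrite /chord => /eq_vtx-> /eq_vtx->.
Qed.

Lemma chordDl a b : chord (a + N) b = chord a b.
Proof. by apply: eq_chord => //; rewrite modnDr. Qed.

Lemma chordDr a b : chord a (b + N) = chord a b.
Proof. by apply: eq_chord => //; rewrite modnDr. Qed.

Lemma chord_inj a b c d : chord a b = chord c d ->
  (a = c %[mod N] /\ b = d %[mod N]) \/ (a = d %[mod N] /\ b = c %[mod N]).
Proof.
move=> /setP E.
have := E (vtx a); have := E (vtx b); have := E (vtx c); have := E (vtx d).
rewrite !inE !eqxx ?orbT /= -!val_eqE /=.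
by move: (a %% N) (b %% N) (c %% N) (d %% N) => *; lia.
Qed.

Lemma chord_inj_small a b c d : a < b < N -> c < d < N -> chord a b = chord c d ->
  a = c /\ b = d.
Proof. by move=> ab cd /chord_inj; rewrite !modn_small; lia. Qed.

Lemma rotateK : involutive (@rotate n).
Proof.
have rotate_vertexK : involutive (@rotate_vertex n).
  move=> v; apply: val_inj.
  by rewrite /= modnDml -addnA addnn -mul2n modnDr modn_small.
move=> s; rewrite /rotate -imset_comp -[RHS]imset_id; apply: eq_imset => v /=.
exact: rotate_vertexK.
Qed.

Lemma rotate_chord a b : rotate (chord a b) = chord (a + n) (b + n).
Proof.
have rotate_vtx c : rotate_vertex (vtx c) = vtx (c + n).
  by apply: val_inj; rewrite /= modnDml.
by rewrite /rotate /chord imsetU1 imset_set1 !rotate_vtx.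
Qed.

Lemma rotation_orbit_rotate s : rotation_orbit (rotate s) = rotation_orbit s.
Proof. by rewrite /rotation_orbit rotateK setUC. Qed.

Lemma rotation_orbit_chord a b :
  rotation_orbit (chord (a + n) (b + n)) = rotation_orbit (chord a b).
Proof. by rewrite -rotate_chord rotation_orbit_rotate. Qed.

Lemma crossingC s t : crossing s t = crossing t s.
Proof.
apply: eq_existsb => a; apply: eq_existsb => b.
apply: eq_existsb => c; apply: eq_existsb => d.
by rewrite orbC ![(s == _) && _]andbC.
Qed.

Lemma crossing_chord_ord a b c d : a < b -> b < c -> c < d -> d < N ->
  crossing (chord a c) (chord b d).
Proof.
move=> ab bc cd dN; apply/existsP; exists (vtx a); apply/existsP; exists (vtx b).
apply/existsP; exists (vtx c); apply/existsP; exists (vtx d).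
by rewrite /= !modn_small ?eqxx ?andbT; lia.
Qed.

Lemma crossingP s t : crossing s t -> exists a b c d,
  [/\ a < b, b < c, c < d, d < N &
    (s = chord a c /\ t = chord b d) \/ (s = chord b d /\ t = chord a c)].
Proof.
case/existsP=> a /existsP[b /existsP[c /existsP[d /and4P[ab bc cd st]]]].
exists a, b, c, d; split=> //; rewrite /chord !vtx_ord.
by case/orP: st => /andP[/eqP-> /eqP->]; [left | right].
Qed.

Lemma crossing_irr : irreflexive (@crossing n).
Proof.
move=> s; apply/negbTE/negP => /crossingP[a [b [c [d [ab bc cd dN]]]]].
by case=> -[-> /chord_inj_small[]]; lia.
Qed.

Lemma has_crossing_pairwise (L : seq (segment n)) (A : {set segment n}) :
  {subset L <= A} -> pairwise (@crossing n) L -> has_crossing (size L) A.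
Proof.
move=> LA crL; apply/existsP; exists [set:: L]; apply/and3P; split.
- by apply/subsetP => s; rewrite inE => /LA.
- by rewrite cardsE; apply/eqP/card_uniqP/(pairwise_uniq crossing_irr).
have : all2rel (fun s t => (s != t) ==> crossing s t) L.
  elim: L crL {LA} => //= s L IH /andP[/allP cr_s /IH].
  rewrite all2rel_cons => [|s' t']; last by rewrite eq_sym crossingC.
  by rewrite eqxx /= => ->; rewrite andbT; apply/allP => t /cr_s->; rewrite implybT.
move=> /allrelP cr; apply/forall_inP => s; rewrite inE => sL.
by apply/forall_inP => t; rewrite inE => tL; exact: cr.
Qed.

Definition interleave p r := [&& lt_pair p r, r.1 < p.2 & r.2 < p.1 + N].

Lemma pairwise_interleave_sort (c : seq (nat * nat)) : uniq c ->
    {in c &, forall p r, p != r -> interleave p r \/ interleave r p} ->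
  pairwise interleave (sort (fun p r => p.1 <= r.1) c).
Proof.
move=> uniq_c inter; pose le1 (p r : nat * nat) := p.1 <= r.1.
have le1_trans : transitive le1 by move=> p r u; exact: leq_trans.
have : pairwise (fun p r => le1 p r && (p != r)) (sort le1 c).
  rewrite pairwise_relI -uniq_pairwise sort_uniq uniq_c andbT -sorted_pairwise //.
  by apply: sort_sorted => p r; exact: leq_total.
apply: (sub_in_pairwise (P := mem c)); last by rewrite all_sort; exact/allP.
move=> p r pc rc /andP[le_pr /(inter p r pc rc)[]//].
by move: le_pr; rewrite /le1 /interleave /lt_pair; lia.
Qed.

Lemma crossing_chord p r :
  interleave p r -> crossing (chord p.1 p.2) (chord r.1 r.2).
Proof.
case: p r => a b [c d]; rewrite /interleave /lt_pair /=.
wlog aN : a b c d / a < N => [W inter|].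
  pose a' := a %% N; have a'N : a' < N by rewrite ltn_mod.
  have shift x : a <= x -> a' + (x - a) = x %[mod N].
    by move=> ax; rewrite modnDml subnKC.
  have <- : chord (a' + (a - a)) (a' + (b - a)) = chord a b.
    by apply: eq_chord; apply: shift; lia.
  have <- : chord (a' + (c - a)) (a' + (d - a)) = chord c d.
    by apply: eq_chord; apply: shift; lia.
  by apply: W; lia.
move=> inter; case: (ltnP d N) => dN; first by apply: crossing_chord_ord; lia.
rewrite -(subnK dN) chordDr; case: (ltnP b N) => bN.
  by rewrite [chord c _]chordC crossingC; apply: crossing_chord_ord; lia.
rewrite -(subnK bN) chordDr [chord a _]chordC; case: (ltnP c N) => cN.
  by rewrite [chord c _]chordC; apply: crossing_chord_ord; lia.
by rewrite -(subnK cN) chordDl crossingC; apply: crossing_chord_ord; lia.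
Qed.

Section Strip.
Variable k : nat.

Lemma chord_Omega a b : a + k < b -> b + k < a + N -> chord a b \in Omega n k.
Proof.
have base c d : c + k < d -> d + k < c + N -> d < N -> chord c d \in Omega n k.
  move=> cd dc dN; rewrite inE.
  apply/existsP; exists (vtx c); apply/existsP; exists (vtx d).
  by rewrite eqxx /= -val_eqE /= /cyclic_length /= !modn_small; lia.
move=> ab ba; pose a' := a %% N; have a'N : a' < N by rewrite ltn_mod.
have -> : chord a b = chord a' (a' + (b - a)).
  by apply: eq_chord; rewrite ?modn_mod // modnDml subnKC //; lia.
case: (ltnP (a' + (b - a)) N) => dN; first by apply: base; lia.
by rewrite -(subnK dN) chordDr chordC; apply: base; lia.
Qed.

Lemma OmegaP s : s \in Omega n k -> exists a b,
  [/\ s = chord a b, a + k < b, b + k < a + N & b < N].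
Proof.
rewrite inE => /existsP[a /existsP[b /and3P[/eqP-> ab len]]].
have aN := ltn_ord a; have bN := ltn_ord b.
case: (ltngtP a b) => [lt|lt|/val_inj E]; last by rewrite E eqxx in ab.
  exists a, b; rewrite /chord !vtx_ord; move: len; rewrite /cyclic_length.
  by split=> //; lia.
exists b, a; rewrite /chord !vtx_ord setUC; move: len; rewrite /cyclic_length.
by split=> //; lia.
Qed.

Lemma rotate_Omega s : s \in Omega n k -> rotate s \in Omega n k.
Proof.
by case/OmegaP=> a [b [-> ab ba bN]]; rewrite rotate_chord; apply: chord_Omega; lia.
Qed.

(* The translate of [(a, b)] or [(b, a + N)] by a multiple of [(N, N)] whose sum
   of coordinates lies in [2 N, 3 N). *)
Definition strip_lift a b : nat * nat :=
  if a + b < N then (a + N, b + N) else (b, a + N).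

Lemma chord_strip_lift a b :
  chord (strip_lift a b).1 (strip_lift a b).2 = chord a b.
Proof.
by rewrite /strip_lift; case: ifP => _ /=; rewrite ?chordDl chordDr // chordC.
Qed.

Lemma in_strip_lift s :
  s \in Omega n k -> exists p, in_strip n k p /\ s = chord p.1 p.2.
Proof.
case/OmegaP=> a [b [-> ab ba bN]].
exists (strip_lift a b); rewrite chord_strip_lift.
by rewrite /in_strip /strip_lift; case: ifP => /=; split=> //; lia.
Qed.

Lemma strip_lift_chord p a b : in_strip n k p -> a < b < N ->
  chord p.1 p.2 = chord a b -> p = strip_lift a b.
Proof.
case: p => c d; rewrite /in_strip /strip_lift /= => strip ab /chord_inj.
have [cN dN] : c < 3 * N /\ d < 3 * N by lia.
have [aN bN] : a < 3 * N /\ b < 3 * N by lia.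
move=> [] [/eq_modn_lt3 c_eq /eq_modn_lt3 d_eq].
  by have := (c_eq cN aN, d_eq dN bN); case: ifP => s [] *; congr pair; lia.
by have := (c_eq cN bN, d_eq dN aN); case: ifP => s [] *; congr pair; lia.
Qed.

Lemma crossing_interleave p r : in_strip n k p -> in_strip n k r ->
  crossing (chord p.1 p.2) (chord r.1 r.2) -> interleave p r \/ interleave r p.
Proof.
wlog cross : p r / exists a b c d, [/\ a < b, b < c, c < d, d < N &
    chord p.1 p.2 = chord a c /\ chord r.1 r.2 = chord b d].
  move=> W pS rS cr; have [a [b [c [d [ab bc cd dN]]]]] := crossingP cr.
  case=> -[pE rE]; first by apply: W => //; exists a, b, c, d.
  by apply/or_comm/W; rewrite 1?crossingC //; exists a, b, c, d.
have [a [b [c [d [ab bc cd dN [pE rE]]]]]] := cross.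
move=> pS rS _; have acN : a < c < N by lia.
have bdN : b < d < N by lia.
rewrite (strip_lift_chord pS acN pE) (strip_lift_chord rS bdN rE).
rewrite /strip_lift /interleave /lt_pair.
by case: (ltnP (a + c) N) => ac; case: (ltnP (b + d) N) => bd /=;
  [left | right | lia | left]; lia.
Qed.

Lemma interleaved_chain (X : {set segment n}) : X \subset Omega n k ->
    {in X &, forall s t, s != t -> crossing s t} ->
  exists c : seq (nat * nat), [/\ size c = #|X|, pairwise interleave c,
    all (in_strip n k) c & all (fun p => chord p.1 p.2 \in X) c].
Proof.
move=> /subsetP XO crX.
have /fin_all_exists[f fP] s :
    exists p, s \in X -> in_strip n k p /\ s = chord p.1 p.2.
  case: (boolP (s \in X)) => [/XO/in_strip_lift[p pP]|_]; first by exists p.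
  by exists (0, 0).
pose c := [seq f s | s <- enum X].
have cP p : p \in c -> exists2 s, s \in X & p = f s.
  by case/mapP=> s; rewrite mem_enum => sX ->; exists s.
have uniq_c : uniq c.
  rewrite map_inj_in_uniq ?enum_uniq // => s t; rewrite !mem_enum.
  by move=> /fP[_ sE] /fP[_ tE] st; rewrite sE st -tE.
exists (sort (fun p r => p.1 <= r.1) c).
rewrite size_sort size_map -cardE !all_sort; split=> //.
- apply: pairwise_interleave_sort => // p r /cP[s sX ->] /cP[t tX ->] neq.
  have [[sS sE] [tS tE]] := (fP s sX, fP t tX).
  apply: crossing_interleave => //; rewrite -sE -tE; apply: crX => //.
  by apply: contraNneq neq => ->.
- by apply/allP => p /cP[s /fP[? _] ->].
by apply/allP => p /cP[s sX ->]; have [_ <-] := fP s sX.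
Qed.

End Strip.

End Polygon.

Lemma interleaved_box n k c : size c = k.+1 ->
    pairwise (interleave n) c -> all (in_strip n k) c ->
  exists a0 b0 q, [/\ node n k 0 q a0 b0, q <= 2 * (n - k)
    & all (in_box a0 b0 b0 (a0 + 2 * n)) c].
Proof.
case: c => // p c [size_c] inter_c strip_c.
have lt_c : pairwise lt_pair (p :: c).
  by apply: sub_pairwise inter_c => u w /and3P[].
pose r := last p c; have rc : r \in p :: c by exact: mem_last.
have bounds (u : nat * nat) :
    u \in p :: c -> (p.1 <= u.1 <= r.1) && (p.2 <= u.2 <= r.2).
  exact: lt_pair_chain_bounds.
have [gap1 gap2] := lt_pair_chain_size lt_c; rewrite size_c -/r in gap1 gap2.
have := allP strip_c _ (mem_head _ _); have := allP strip_c _ rc.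
rewrite /in_strip => strip_r strip_p.
have [rp pr] : r.1 < p.2 /\ r.2 < p.1 + 2 * n.
  move: inter_c rc; rewrite pairwise_cons inE => /andP[/allP inter_p _].
  by case/predU1P=> [->|/inter_p/and3P[_ -> ->]//]; lia.
(* An initial node has coordinates with sum 2 (2 n) - 2 or 2 (2 n) - 1; only the
   former lies strictly below [p] when the sum for [p] is 2 (2 n). *)
pose T := if p.1 + p.2 == 2 * (2 * n) then 2 * (2 * n) - 2 else 2 * (2 * n) - 1.
have TE : T = 2 * (2 * n) - 2 /\ p.1 + p.2 = 2 * (2 * n) \/
    T = 2 * (2 * n) - 1 /\ 2 * (2 * n) < p.1 + p.2.
  by rewrite /T; case: eqP; [left | right]; lia.
pose a0 := maxn (r.2 - 2 * n) (T - p.2.-1); pose b0 := T - a0.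
have box : [/\ a0 + b0 = T, r.2 - 2 * n <= a0, a0 < p.1, r.1 <= b0 & b0 < p.2].
  by rewrite /b0 /a0; split; lia.
move: a0 b0 box => a0 b0 [ab r2a a0p r1b b0p]; exists a0, b0, (b0 - a0 - k); split.
- by split; [lia | case: TE; lia].
- lia.
by apply/allP => -[u1 u2] /bounds; rewrite /in_box /=; lia.
Qed.

(** * The word of the network *)

Section Word.
Variables n k : nat.
Hypothesis k_ltn : k < n.
Local Notation N := (2 * n).
Local Notation m := (n - k).
Local Notation M := (2 * (n - k)).

Fact polygon_gt0 : 0 < N.
Proof. lia. Qed.
Local Notation seg := (chord polygon_gt0).

(* The segment [a, b] with b - a = i + k and a + b = 2 N + t; junk unless
   t + i + k is even. *)
Definition chord_at t i : segment n :=
  let a := (2 * N + t - i - k) %/ 2 in seg a (a + i + k).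

Definition orbit_at t (l : 'I_m) : {set segment n} :=
  rotation_orbit (chord_at t l.+1).

Definition generators_at t : seq 'I_m :=
  [seq l : 'I_m <- enum 'I_m | ~~ odd (t + l.+1 + k)].

(* Later letters come first, as [demazure] lets the head act last. *)
Fixpoint word t : seq ({set segment n} * 'I_m) :=
  if t is t'.+1
  then [seq (orbit_at t' l, l) | l <- generators_at t'] ++ word t' else [::].

Lemma generators_atP t (l : 'I_m) :
  reflect (exists a, 2 * a + l.+1 + k = 2 * N + t) (l \in generators_at t).
Proof.
rewrite mem_filter mem_enum andbT; have := ltn_ord l => lm.
apply: (iffP idP) => [ev|[a Ea]]; last by lia.
by exists ((2 * N + t - l.+1 - k) %/ 2); lia.
Qed.

Lemma chord_atE t i a :
  2 * a + i + k = 2 * N + t -> chord_at t i = seg a (a + i + k).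
Proof. by move=> Ea; rewrite /chord_at (_ : _ %/ 2 = a) //; lia. Qed.

Lemma mem_word v t :
  reflect (exists t' l, [/\ t' < t, l \in generators_at t' & v = orbit_at t' l])
  (v \in unzip1 (word t)).
Proof.
elim: t => [|t IH] /=; first by constructor=> -[? [? []]].
rewrite /unzip1 map_cat mem_cat -map_comp; apply: (iffP orP).
  case=> [/mapP[l lt ->]|/IH[t' [l [lt lt' ->]]]]; first by exists t, l.
  by exists t', l; split=> //; exact: ltnW.
move=> [t' [l [lt lt' vE]]]; move: lt; rewrite ltnS leq_eqVlt => /predU1P[tE|lt].
  by left; rewrite vE; apply/mapP; exists l; rewrite // -tE.
by right; apply/IH; exists t', l.
Qed.

Lemma orbit_at_inj t l t' l' :
  t < N -> t' < N -> l \in generators_at t -> l' \in generators_at t' ->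
  orbit_at t l = orbit_at t' l' -> t = t' /\ l = l'.
Proof.
move=> tN t'N /generators_atP[a Ea] /generators_atP[a' Ea'] same.
suff : t = t' /\ l = l' :> nat by case=> -> /val_inj->.
have := ltn_ord l; have := ltn_ord l' => lm' lm.
have : chord_at t l.+1 \in orbit_at t' l' by rewrite -same !inE eqxx.
rewrite !inE (chord_atE Ea) (chord_atE Ea') rotate_chord.
by case/orP=> /eqP /chord_inj[] [/eq_modn_lt3 e1 /eq_modn_lt3 e2]; lia.
Qed.

Lemma uniq_word : uniq (unzip1 (word N)).
Proof.
suff : forall t, t <= N -> uniq (unzip1 (word t)) by apply.
elim=> //= t IH tN; rewrite /unzip1 map_cat cat_uniq -/(unzip1 _).
rewrite IH ?(ltnW tN) // andbT; apply/andP; split.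
  rewrite /unzip1 -map_comp map_inj_in_uniq; first exact/filter_uniq/enum_uniq.
  by move=> l l' lt lt' /orbit_at_inj[].
apply/hasPn => v /mem_word[t' [l [lt lt' ->]]].
apply/negP; rewrite /= /unzip1 -map_comp => /mapP[l' l't].
by case/orbit_at_inj; lia || exact: ltn_trans lt tN.
Qed.

Lemma rotation_orbit_in_word t i a :
  t < N -> 0 < i <= m -> 2 * a + i + k = 2 * N + t ->
  rotation_orbit (seg a (a + i + k)) \in unzip1 (word N).
Proof.
move=> tN /andP[i0 im] Ea; have im' : i.-1 < m by lia.
apply/mem_word; exists t, (Ordinal im'); split=> //.
  by apply/generators_atP; exists a; rewrite /= prednK.
by rewrite /orbit_at /= prednK // (chord_atE Ea).
Qed.

Lemma word_orbits : [set:: unzip1 (word N)] = orbits n k.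
Proof.
apply/setP => v; rewrite inE; apply/idP/imsetP.
  case/mem_word=> t [l [tN /generators_atP[a Ea] ->]].
  have lm := ltn_ord l; exists (chord_at t l.+1) => //.
  by rewrite (chord_atE Ea); apply: chord_Omega; lia.
(* Swapping the endpoints and rotating by the half-turn, one finds in each orbit
   a lift [a, b] with b - a <= n and 2 N <= a + b < 3 N. *)
move=> [s /(OmegaP polygon_gt0)[a [b [-> ab ba bN]]] ->].
case: (leqP (b - a) n) => short; case: (ltnP (a + b) N) => early.
- have := @rotation_orbit_in_word (a + b) (b - a - k) (a + N).
  rewrite chordDl (_ : a + N + _ + k = b + N) ?chordDr; last lia.
  by apply; lia.
- have := @rotation_orbit_in_word (a + b - N) (b - a - k) (a + n).
  rewrite (_ : a + n + _ + k = b + n) ?rotation_orbit_chord; last lia.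
  by apply; lia.
- have := @rotation_orbit_in_word (a + b) (N - (b - a) - k) (b + n).
  rewrite (_ : b + n + _ + k = a + N + n); last lia.
  rewrite rotation_orbit_chord chordDr chordC.
  by apply; lia.
have := @rotation_orbit_in_word (a + b - N) (N - (b - a) - k) b.
rewrite (_ : b + _ + k = a + N); last lia.
rewrite chordDr chordC.
by apply; lia.
Qed.

Lemma size_word : size (word N) = n * m.
Proof.
suff : forall j, size (word (2 * j)) = j * m by apply.
elim=> [|j IH]; first by rewrite muln0.
rewrite mulnS /= !size_cat !size_map IH mulSn addnA; congr (_ + _).
pose even_at (l : 'I_m) := ~~ odd ((2 * j).+1 + l.+1 + k).
rewrite !size_filter -[RHS]size_enum_ord -(count_predC even_at).
by congr (_ + _); apply: eq_count => l; rewrite /even_at /=; lia.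
Qed.

Lemma mem_cover_orbits (sigma : {set {set segment n}}) (s : segment n) :
  sigma \subset orbits n k -> (s \in cover sigma) = (rotation_orbit s \in sigma).
Proof.
move=> /subsetP so; apply/bigcupP/idP => [[o os]|sS]; last first.
  by exists (rotation_orbit s); rewrite // !inE eqxx.
have /imsetP[s0 _ oE] := so _ os; move: os; rewrite oE => os.
by rewrite !inE => /orP[] /eqP->; rewrite ?rotation_orbit_rotate.
Qed.

Lemma cover_sub_Omega (sigma : {set {set segment n}}) :
  sigma \subset orbits n k -> cover sigma \subset Omega n k.
Proof.
move=> /subsetP so; apply/subsetP => s /bigcupP[o /so/imsetP[s0 s0O ->]].
by rewrite in_set2 => /orP[]/eqP-> //; exact: (rotate_Omega polygon_gt0).
Qed.

Section Faces.
Variable sigma : {set {set segment n}}.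
Hypothesis sigma_sub : sigma \subset orbits n k.

Definition state t : signed_perm m :=
  demazure (raise (m := m)) (signed_id m) (word t) sigma.

Definition active_at t := [seq l <- generators_at t | orbit_at t l \notin sigma].

Lemma stateS t : state t.+1 = foldr (raise (m := m)) (state t) (active_at t).
Proof.
rewrite /state /= /demazure foldr_cat -/(demazure _ _ _ _) -/(state t) /active_at.
by elim: (generators_at t) => //= l L ->; case: ifP.
Qed.

Lemma height_stateS t q j : height (state t.+1) q j =
  if has (fun l => moved l j) (active_at t)
  then minn (height (state t) q j.-1).+1 (height (state t) q j.+1)
  else height (state t) q j.
Proof.
rewrite stateS height_raise_parity // => l l'.
by rewrite !mem_filter => /andP[_ /andP[ev _]] /andP[_ /andP[ev' _]]; lia.
Qed.

Lemma active_at_even t j :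
  has (fun l => moved l j) (active_at t) -> 0 < j < M /\ ~~ odd (t + j + k).
Proof.
case/hasP=> l; rewrite !mem_filter => /andP[_ /andP[ev _]] mj.
by have := ltn_ord l; move: mj; rewrite /moved; lia.
Qed.

Lemma active_atE t j a : 0 < j < M -> 2 * a + j + k = 2 * N + t ->
  has (fun l => moved l j) (active_at t) = (seg a (a + j + k) \notin cover sigma).
Proof.
move=> jM Ea; rewrite mem_cover_orbits //.
have im : (minn j (M - j)).-1 < m by lia.
pose i := Ordinal im; have iE : i.+1 = minn j (M - j) by rewrite /=; lia.
have orbit_i : orbit_at t i = rotation_orbit (seg a (a + j + k)).
  rewrite /orbit_at iE.
  case: (leqP j (M - j)) => ji; first by rewrite (chord_atE Ea).
  have Ea' : 2 * (a + j + k - n) + (M - j) + k = 2 * N + t by lia.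
  rewrite (chord_atE Ea') -rotation_orbit_chord chordC; congr rotation_orbit.
  rewrite (_ : _ + k + n = a + N); last by lia.
  by rewrite chordDl (_ : _ - n + n = a + j + k) //; lia.
have moved_i l : moved l j = (l == i).
  by rewrite -val_eqE /= /moved; have := ltn_ord l; lia.
rewrite -orbit_i; apply/hasP/idP => [[l]|active_i].
  by rewrite mem_filter moved_i => /andP[+ _] /eqP<-.
exists i; last by rewrite moved_i.
rewrite mem_filter active_i; apply/generators_atP; rewrite iE.
by exists ((2 * N + t - minn j (M - j) - k) %/ 2); lia.
Qed.

Lemma state_heights q : q <= M ->
  network_heights n k (fun p => seg p.1 p.2 \in cover sigma) q
    (fun t i => height (state t) q i).
Proof.
move=> qM; split.
- by move=> i _; rewrite /state /= height_id.
- by move=> t; rewrite height0.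
- by move=> t; exact: height_signed.
- by move=> t; exact: leq_height.
- by move=> t; exact: leq_height_add.
- move=> t i a Ea; rewrite height_stateS; case: ifP => // /active_at_even[_].
  by rewrite (_ : odd _ = true) //; lia.
by move=> t i a iM Ea; rewrite height_stateS (active_atE iM Ea) if_neg.
Qed.

Lemma bruhat_rev_stateP :
  reflect (forall q, q <= M -> M - q <= height (state N) q (M - q))
  (bruhat (signed_rev m) (state N)).
Proof.
apply: (iffP (bruhatP _ _)) => [ge q qM|ge q i qM iM].
  by have := ge q (M - q) qM (leq_subr _ _); rewrite height_rev ?leq_subr // minnn.
have := ge q qM; rewrite height_rev //; case: (leqP i (M - q)) => iq.
  by have := leq_height_add (state N) q i (M - q - i); rewrite subnKC //; lia.
by move=> /leq_trans; apply; apply: leq_height; exact: ltnW.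
Qed.

Lemma has_crossing_low_height : has_crossing k.+1 (cover sigma) ->
  exists2 q, q <= M & height (state N) q (M - q) < M - q.
Proof.
case/existsP=> X /and3P[X_sub /eqP size_X /forall_inP crX].
have [|s t sX tX|c [size_c inter_c strip_c in_c]] :=
  @interleaved_chain _ polygon_gt0 k X.
- exact: subset_trans X_sub (cover_sub_Omega sigma_sub).
- by have /forall_inP/(_ t tX)/implyP := crX s sX.
rewrite size_X in size_c.
have [a0 [b0 [q [nd qM box_c]]]] := interleaved_box size_c inter_c strip_c.
exists q => //.
apply: (box_chain_low_height k_ltn (state_heights qM) nd) strip_c => //.
rewrite /box_chain (sub_pairwise _ inter_c) => [|p r /and3P[]//].
by apply/allP => p pc; rewrite (allP box_c) // (subsetP X_sub) // (allP in_c).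
Qed.

Lemma box_chain_has_crossing a0 b0 c : size c = k.+1 ->
    box_chain (fun p => seg p.1 p.2 \in cover sigma) a0 b0 b0 (a0 + N) c ->
  has_crossing k.+1 (cover sigma).
Proof.
move=> size_c /andP[lt_c /allP in_c].
rewrite -size_c -(size_map (fun p => seg p.1 p.2)).
apply: (has_crossing_pairwise polygon_gt0).
  by move=> s /mapP[p /in_c/andP[_ +] ->].
rewrite pairwise_map; apply: (sub_in_pairwise (P := mem c)) lt_c; last exact/allP.
move=> p r /in_c/andP[box_p _] /in_c/andP[box_r _] lt_pr.
apply: (crossing_chord polygon_gt0).
by move: box_p box_r lt_pr; rewrite /in_box /interleave /lt_pair; lia.
Qed.

Theorem bruhat_rev_state_crossing :
  bruhat (signed_rev m) (state N) = ~~ has_crossing k.+1 (cover sigma).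
Proof.
apply/bruhat_rev_stateP/negP => [ge /has_crossing_low_height[q qM]|nocross q qM].
  by rewrite ltnNge ge.
rewrite leqNgt; apply/negP => low; apply: nocross.
have [a0 [b0 [c [size_c]]]] :=
  low_height_box_chain k_ltn (state_heights qM) qM low.
exact: box_chain_has_crossing.
Qed.

Lemma size_word_minus :
  size [seq p <- word N | p.1 \notin sigma] + #|sigma| = n * m.
Proof.
rewrite -size_word size_filter -(count_predC (fun p => p.1 \notin sigma)).
congr (_ + _).
rewrite -(count_map fst (predC (fun v => v \notin sigma))) -size_filter.
have /card_uniqP <- := filter_uniq (predC (fun v => v \notin sigma)) uniq_word.
apply: eq_card => v; rewrite mem_filter /= negbK; apply/esym/andb_idr => v_sigma.
by have := subsetP sigma_sub v v_sigma; rewrite -word_orbits inE.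
Qed.

End Faces.

Lemma Dstar_subword :
  Dstar n k =
    subword (@bruhat m) (raise (m := m)) (signed_id m) (word N) (signed_rev m).
Proof.
apply/setP => sigma; rewrite !inE word_orbits; apply: andb_id2l => sigma_sub.
by rewrite -(bruhat_rev_state_crossing sigma_sub).
Qed.

Lemma simplicial_link_Dstar sigma :
  sigma \in Dstar n k -> simplicial (link (Dstar n k) sigma).
Proof.
rewrite inE -word_orbits => /andP[sigma_sub _].
rewrite Dstar_subword (link_subword (demazure_signed m)) //.
exact: (simplicial_subword (demazure_signed m)).
Qed.

Theorem homology_sphere_link_Dstar sigma : sigma \in Dstar n k ->
  exists2 d, d + #|sigma| = k * m & homology_sphere d (link (Dstar n k) sigma).
Proof.
move=> face; have := face; rewrite inE => /andP[sigma_sub _].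
have le_rev : bruhat (signed_rev m) (state sigma N).
  by move: face; rewrite Dstar_subword inE => /andP[].
rewrite Dstar_subword (link_subword (demazure_signed m)) ?word_orbits //.
set Q := filter _ _.
have stateE : demazure (raise (m := m)) (signed_id m) Q set0 = state sigma N.
  by rewrite demazure_filter set0U.
have [|||d dE sph] :=
  homology_sphere_subword (demazure_signed m) (x := signed_rev m) (Q := Q).
- by apply: subseq_uniq uniq_word; apply: map_subseq; exact: filter_subseq.
- by rewrite stateE.
- by rewrite bruhat_rev.
exists d => //; have := size_word_minus sigma_sub.
rewrite -/Q -dE signed_length_rev addnAC => /(canRL (addnK _)) ->.
by rewrite -mulnBl subKn // ltnW.
Qed.

End Word.

Lemma link_set0 (V : finType) (Delta : {set {set V}}) : link Delta set0 = Delta.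
Proof. by apply/setP => F; rewrite !inE setU0 setI0 eqxx andbT andbb. Qed.

Lemma set0_Dstar n k : set0 \in Dstar n k.
Proof.
rewrite inE sub0set /cover big_set0; apply/existsP => -[X /and3P[+ /eqP X_size _]].
by rewrite subset0 -cards_eq0 X_size.
Qed.

Local Open Scope ring_scope.

Theorem theorem3p5 (n k : nat) (hn : (2 <= n)%N) (hk : (1 <= k <= n - 1)%N) :
  (forall sigma : {set {set segment n}}, sigma \in Dstar n k ->
     has_sphere_homology (link (Dstar n k) sigma)
       ((k * (n - k))%N%:Z - 1 - face_dim sigma - 1)) /\
  has_sphere_homology (Dstar n k) ((k * (n - k))%N%:Z - 1).
Proof.
have k_ltn : (k < n)%N by lia.
have link_sphere sigma : sigma \in Dstar n k ->
    has_sphere_homology (link (Dstar n k) sigma)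
      ((k * (n - k))%N%:Z - #|sigma|%:Z - 1).
  move=> face; have [d dE sph] := homology_sphere_link_Dstar k_ltn face.
  rewrite -dE PoszD addrK; apply: has_sphere_homology_reduced sph.
  exact: simplicial_link_Dstar.
split=> [sigma face|].
  suff -> : (k * (n - k))%N%:Z - 1 - face_dim sigma - 1 =
      (k * (n - k))%N%:Z - #|sigma|%:Z - 1 by exact: link_sphere.
  by rewrite /face_dim; lia.
by have := link_sphere set0 (set0_Dstar n k); rewrite link_set0 cards0 subr0.
Qed.
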